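(* Let $M\in\mathbb R$, $M\ne0$, let $\Phi_c$ ($c>0$) and $f_M$ be the explicit profiles defined in the context, and fix $R>0$. There exist $c_1=c_1(R,M)>0$ and $\kappa_-=\kappa_-(M,R)>0$ such that, for $0<c\le c_1$: (i) for every integer $k\ge0$ there exists $\kappa_{+,k}=\kappa_{+,k}(M,R)>0$ such that $$\|\Phi_c-f_M\|_{C^k([0,R])}\le\kappa_{+,k}\,c^{-k/2}\exp\Big(-\frac1c+\frac R{\sqrt c}\Big),$$ and hence, for every $\varepsilon>0$, with $C_{k,\varepsilon}$ independent of $c$, $$\|\Phi_c-f_M\|_{C^k([0,R])}\le C_{k,\varepsilon}\,e^{-(1-\varepsilon)/c};$$ (ii) at $\xi=0$, $$|\Phi_c(0)-f_M(0)|=\frac{2|e^M-1|}{\sqrt\pi}\,e^{-1/c}\bigl(1+O(e^{-3/c})\bigr),\qquad c\to0^+;$$ in particular $|\Phi_c(0)-f_M(0)|\ge\kappa_-\,e^{-1/c}$ and $$\lim_{c\to0^+}-c\ln|\Phi_c(0)-f_M(0)|=1.$$ Therefore the exponent $1$ is attained (at $\xi=0$, in the sense of the last limit), and no larger exponent is admissible: for no $\gamma>1$ is there a constant $C$ with $\|\Phi_c-f_M\|_{C^k([0,R])}\le Ce^{-\gamma/c}$ for all sufficiently small $c>0$.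
   Context: The function $\varphi$ is the solution of $\varphi_\tau=\varphi_{yy}$ on $(0,1)\times(0,\infty)$, $\varphi(0,\tau)=0$, $\varphi(1,\tau)=1$, $\varphi(y,0)=1$; explicitly $$\varphi(y,\tau)=y+\frac2\pi\sum_{n\ge1}\frac{\sin(n\pi y)}{n}e^{-n^2\pi^2\tau},\qquad \tau>0.$$ For $c>0$ and $0\le\xi\le c^{-1/2}$, $$\Phi_c(\xi)=\sqrt c\,\frac{(e^M-1)\,\varphi_y(\xi\sqrt c,c)}{1+(e^M-1)\,\varphi(\xi\sqrt c,c)}.$$ For $\xi\ge0$, $$f_M(\xi)=\frac{(e^M-1)\,b(\xi)}{1+(e^M-1)\int_0^\xi b},\qquad b(\xi)=\pi^{-1/2}e^{-\xi^2/4}.$$ The number $c_1$ is in particular small enough that $R\le c^{-1/2}$ for $c\le c_1$, so $\Phi_c$ is defined on $[0,R]$. *)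

(* Defs.v *)
From Stdlib Require Import Reals.
From Coquelicot Require Import Coquelicot.

Open Scope R_scope.

(** Only used for [tau > 0]; the series then defines a smooth function of
    [y] on the whole line, so that the two-sided derivative in [phi_y] is the
    one-sided one at the end points of [0 <= y <= 1]. *)
Definition phi_term (y tau : R) (n : nat) : R :=
  sin (INR n * PI * y) / INR n * exp (- (INR n ^ 2 * PI ^ 2 * tau)).

Definition phi (y tau : R) : R :=
  y + 2 / PI * Series (fun n => phi_term y tau (S n)).

Definition phi_y (y tau : R) : R := Derive (fun z => phi z tau) y.

Definition Phi_c (M c xi : R) : R :=
  sqrt c * ((exp M - 1) * phi_y (xi * sqrt c) c
            / (1 + (exp M - 1) * phi (xi * sqrt c) c)).

Definition b_gauss (xi : R) : R := / sqrt PI * exp (- (xi ^ 2 / 4)).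

Definition f_M (M xi : R) : R :=
  (exp M - 1) * b_gauss xi / (1 + (exp M - 1) * RInt b_gauss 0 xi).

(** Derivatives relative to the closed interval [lo <= x <= hi]: one-sided at
    the end points, and insensitive to values outside the interval. *)
Definition is_derive_on (lo hi : R) (g : R -> R) (x l : R) : Prop :=
  filterlim (fun y => (g y - g x) / (y - x))
    (within (fun y => lo <= y <= hi) (locally' x)) (locally l).

Definition Derive_on (lo hi : R) (g : R -> R) (x : R) : R :=
  iota (is_derive_on lo hi g x).

Fixpoint Derive_n_on (lo hi : R) (g : R -> R) (n : nat) : R -> R :=
  match n with
  | O => g
  | S m => Derive_on lo hi (Derive_n_on lo hi g m)
  end.

Definition continuous_within (lo hi : R) (g : R -> R) (x : R) : Prop :=
  filterlim g (within (fun y => lo <= y <= hi) (locally x)) (locally (g x)).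

Definition is_Ck (k : nat) (lo hi : R) (g : R -> R) : Prop :=
  (forall (j : nat) (x : R), (j < k)%nat -> lo <= x <= hi ->
     exists l : R, is_derive_on lo hi (Derive_n_on lo hi g j) x l) /\
  (forall (j : nat) (x : R), (j <= k)%nat -> lo <= x <= hi ->
     continuous_within lo hi (Derive_n_on lo hi g j) x).

(** The supremum of [|g^(j)(x)|] over [j <= k] and [lo <= x <= hi]; it is
    [p_infty] when one of the derivatives is unbounded. *)
Definition Ck_norm (k : nat) (lo hi : R) (g : R -> R) : Rbar :=
  Lub_Rbar (fun r => exists (j : nat) (x : R),
    (j <= k)%nat /\ lo <= x <= hi /\ r = Rabs (Derive_n_on lo hi g j x)).

(* Main.v *)
Require Import Defs.
From Stdlib Require Import Reals Lra Lia.
From Coquelicot Require Import Coquelicot.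

Open Scope R_scope.

(** Jacobi's identity turns [sqrt c * phi_y (xi sqrt c) c] into the sum of the Gaussians
    [exp (- (xi / 2 - m / sqrt c) ^ 2) / sqrt PI] over the integers [m]: the term [m = 0] is
    [b_gauss], and the others are the error, dominated by [exp (- 1 / c + xi / sqrt c)]. At [xi = 0]
    both denominators are [1], so that the error there is [2 / sqrt PI] times the sum of
    [exp (- m ^ 2 / c)] over [m >= 1], up to the factor [exp M - 1].

    The identity is proved by comparing cosine coefficients on [0 <= y <= 1]: unfolding the sum of
    images gives the cosine transform of the Gaussian, found by a contour shift, and a continuous
    function whose cosine coefficients all vanish is zero. The remaining constant, the Gaussian
    integral, is read off from the identity itself at its self-dual parameter. *)

(** * Series of functions with local domination *)

(** For small [c] the cosine series is useless for the error, since many of its terms are of order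
    one; on the image side all terms are positive and exponentially graded. Positivity also controls
    the denominators: it places both integrals in [0, 1], so that each denominator is a convex
    combination of 1 and [exp M], bounded below for either sign of [M].

    The higher norms are the other obstacle, as the profiles are quotients. Over the common
    denominator every term of the numerator carries one exponentially small factor. A class of
    families in which each derivative costs [1 / sqrt c], the price of differentiating
    [exp (m * xi / sqrt c)] in [xi], is closed under sums, products and inverses, and so yields
    every [k] without a formula for the derivatives of a quotient.

    No improper integral is formed: the half-line Gaussian integral enters only through limits over
    bounded intervals. Scaling determines its dependence on the parameter, which is why a single
    self-dual value suffices. *)

Lemma ex_RInt_continuous_global (f : R -> R) (a b : R) :
  (forall x, continuous f x) -> ex_RInt f a b.
Proof. intros H. apply (ex_RInt_continuous (V := R_CompleteNormedModule)). intros z _. apply H. Qed.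

Lemma is_derive_continuous (f : R -> R) (x l : R) : is_derive f x l -> continuous f x.
Proof.
  intros H. apply (ex_derive_continuous (V := R_NormedModule)). exists l; exact H.
Qed.

(** The bound on the tail mentions only [B]. When [u] depends on a point, it is therefore uniform in
    that point, which is how uniform convergence enters below. *)
Lemma Series_tail_le (u B : nat -> R) (n : nat) :
  ex_series B -> (forall k, Rabs (u k) <= B k) ->
  Rabs (Series u - sum_n u n) <= Series B - sum_n B n.
Proof.
  intros HB Hu.
  assert (Hu' : ex_series u) by (apply (ex_series_le u B); assumption).
  rewrite (Series_incr_n u (S n)), (Series_incr_n B (S n)); try assumption; try lia.
  simpl pred. rewrite <- !sum_n_Reals.
  assert (HBt : ex_series (fun k => B (S n + k)%nat)) by (apply ex_series_incr_n; assumption).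
  assert (Hub : forall k, Rabs (u (S n + k)%nat) <= B (S n + k)%nat) by (intros; apply Hu).
  replace (sum_n u n + Series (fun k => u (S n + k)%nat) - sum_n u n)
    with (Series (fun k => u (S n + k)%nat)) by ring.
  replace (sum_n B n + Series (fun k => B (S n + k)%nat) - sum_n B n)
    with (Series (fun k => B (S n + k)%nat)) by ring.
  eapply Rle_trans.
  - apply Series_Rabs. apply (ex_series_le (fun k => Rabs (u (S n + k)%nat)) (fun k => B (S n + k)%nat)).
    + intros k. change norm with Rabs. rewrite Rabs_Rabsolu. apply Hub.
    + exact HBt.
  - apply Series_le; [|exact HBt]. intros k; split; [apply Rabs_pos | apply Hub].
Qed.

Lemma Series_remainder_small (B : nat -> R) (eps : R) :
  ex_series B -> 0 < eps -> exists N, forall n, (N <= n)%nat -> Rabs (Series B - sum_n B n) < eps.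
Proof.
  intros HB He. apply Series_correct in HB.
  apply is_lim_seq_Reals in HB.
  destruct (HB eps He) as [N HN]. exists N. intros n Hn.
  rewrite Rabs_minus_sym. exact (HN n Hn).
Qed.

(** The hypothesis of the Weierstrass test, on bounded sets only: the image terms are translates of
    one Gaussian and have no summable majorant on the whole line. *)
Definition locally_dominated (v : nat -> R -> R) : Prop :=
  forall r : R, exists B : nat -> R,
    ex_series B /\ forall n y, Rabs y <= r -> Rabs (v n y) <= B n.

Lemma locally_dominated_ex_series (v : nat -> R -> R) (y : R) :
  locally_dominated v -> ex_series (fun n => v n y).
Proof.
  intros H. destruct (H (Rabs y)) as [B [HB Hv]].
  apply (ex_series_le (fun n => v n y) B); [|exact HB].
  intros n. apply Hv. apply Rle_refl.
Qed.

Lemma sum_n_continuous (v : nat -> R -> R) (n : nat) (x : R) :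
  (forall k y, continuous (v k) y) -> continuous (fun y => sum_n (fun k => v k y) n) x.
Proof.
  intros Hv. induction n as [|n IH].
  - apply continuous_ext with (v 0%nat); [intros y; symmetry; apply sum_O | apply Hv].
  - apply continuous_ext with (fun y => plus (sum_n (fun k => v k y) n) (v (S n) y)).
    + intros y. symmetry. apply sum_Sn.
    + apply (continuous_plus (V := R_NormedModule)); [exact IH | apply Hv].
Qed.

Lemma Series_continuous (v : nat -> R -> R) (x : R) :
  (forall n y, continuous (v n) y) -> locally_dominated v ->
  continuous (fun y => Series (fun n => v n y)) x.
Proof.
  intros Hc Hd. destruct (Hd (Rabs x + 1)) as [B [HB Hv]].
  apply filterlim_locally. intros eps.
  assert (He3 : 0 < eps / 3) by (pose proof (cond_pos eps); lra).
  destruct (Series_remainder_small B (eps / 3) HB He3) as [N HN].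
  specialize (HN N (le_n N)). apply Rabs_def2 in HN.
  pose proof (proj1 (filterlim_locally _ _) (sum_n_continuous v N x Hc)) as Hs.
  specialize (Hs (mkposreal _ He3)).
  assert (H1 : locally x (fun y => Rabs (y - x) < 1)).
  { exists (mkposreal 1 Rlt_0_1). intros y Hy. exact Hy. }
  generalize (filter_and _ _ H1 Hs). apply filter_imp. intros y [Hy1 Hy2].
  change (Rabs (sum_n (fun k => v k y) N - sum_n (fun k => v k x) N) < eps / 3) in Hy2.
  change (Rabs (Series (fun n => v n y) - Series (fun n => v n x)) < eps).
  assert (Ty : Rabs (Series (fun n => v n y) - sum_n (fun n => v n y) N) <= Series B - sum_n B N).
  { apply Series_tail_le; [exact HB|]. intros k. apply Hv.
    replace y with (x + (y - x)) by ring. eapply Rle_trans; [apply Rabs_triang|]. lra. }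
  assert (Tx : Rabs (Series (fun n => v n x) - sum_n (fun n => v n x) N) <= Series B - sum_n B N).
  { apply Series_tail_le; [exact HB|]. intros k. apply Hv. lra. }
  apply Rabs_le_between in Ty. apply Rabs_le_between in Tx. apply Rabs_def2 in Hy2.
  apply Rabs_def1; lra.
Qed.

Lemma is_RInt_sum_n (v : nat -> R -> R) (a b : R) (n : nat) :
  (forall k y, continuous (v k) y) ->
  is_RInt (fun y => sum_n (fun k => v k y) n) a b (sum_n (fun k => RInt (v k) a b) n).
Proof.
  intros Hv. induction n as [|n IH].
  - rewrite sum_O. apply is_RInt_ext with (v 0%nat).
    + intros y _. symmetry. apply sum_O.
    + apply (RInt_correct (V := R_CompleteNormedModule)). apply ex_RInt_continuous_global, Hv.
  - rewrite sum_Sn.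
    apply is_RInt_ext with (fun y => plus (sum_n (fun k => v k y) n) (v (S n) y)).
    + intros y _. symmetry. apply sum_Sn.
    + apply (is_RInt_plus (V := R_NormedModule)); [exact IH|].
      apply (RInt_correct (V := R_CompleteNormedModule)). apply ex_RInt_continuous_global, Hv.
Qed.

Lemma is_series_RInt (v : nat -> R -> R) (a b : R) :
  (forall n y, continuous (v n) y) -> locally_dominated v ->
  is_series (fun n => RInt (v n) a b) (RInt (fun y => Series (fun n => v n y)) a b).
Proof.
  intros Hc Hd.
  assert (key : forall a b, a <= b ->
     is_series (fun n => RInt (v n) a b) (RInt (fun y => Series (fun n => v n y)) a b)).
  { clear a b. intros a b Hab.
    destruct (Hd (Rmax (Rabs a) (Rabs b))) as [B [HB Hv]].
    apply is_lim_seq_Reals. intros eps Heps.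
    (* The added 1 keeps the denominator positive when [a = b]. *)
    assert (He : 0 < eps / (b - a + 1)) by (apply Rdiv_lt_0_compat; lra).
    destruct (Series_remainder_small B _ HB He) as [N HN]. exists N. intros n Hn.
    specialize (HN n Hn). apply Rabs_def2 in HN.
    unfold Rdist.
    pose proof (is_RInt_sum_n v a b n Hc) as Hs.
    assert (HS : is_RInt (fun y => Series (fun n => v n y)) a b
                  (RInt (fun y => Series (fun n => v n y)) a b)).
    { apply (RInt_correct (V := R_CompleteNormedModule)). apply ex_RInt_continuous_global.
      intros y. apply Series_continuous; assumption. }
    pose proof (is_RInt_minus _ _ _ _ _ _ Hs HS) as HD.
    assert (Hle : Rabs (minus (sum_n (fun k => RInt (v k) a b) n)
                    (RInt (fun y => Series (fun n => v n y)) a b)) <= (b - a) * (eps / (b - a + 1))).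
    { apply (norm_RInt_le_const (V := R_NormedModule)
        (fun y => minus (sum_n (fun k => v k y) n) (Series (fun n => v n y))) a b); auto.
      intros y Hy.
      change (Rabs (sum_n (fun k => v k y) n - Series (fun n => v n y)) <= eps / (b - a + 1)).
      rewrite Rabs_minus_sym.
      apply Rle_trans with (Series B - sum_n B n); [|lra].
      apply Series_tail_le; [exact HB|]. intros k. apply Hv.
      apply Rabs_le_between. unfold Rmax, Rabs.
      destruct (Rle_dec _ _); destruct (Rcase_abs a), (Rcase_abs b); lra. }
    eapply Rle_lt_trans; [exact Hle|].
    apply Rlt_le_trans with ((b - a + 1) * (eps / (b - a + 1))).
    - apply Rmult_lt_compat_r; lra.
    - right; field; lra. }
  destruct (Rle_dec a b) as [Hab|Hab]; [apply key, Hab|].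
  assert (Hba : b <= a) by lra.
  pose proof (key b a Hba) as H.
  apply (is_series_scal (-1)) in H.
  assert (HS : ex_RInt (fun y => Series (fun n => v n y)) b a).
  { apply ex_RInt_continuous_global. intros y. apply Series_continuous; assumption. }
  rewrite <- (opp_RInt_swap (V := R_CompleteNormedModule) _ b a HS).
  change (is_series (fun n => RInt (v n) a b) (- RInt (fun y => Series (fun n => v n y)) b a)).
  replace (- RInt (fun y => Series (fun n => v n y)) b a)
    with (-1 * RInt (fun y => Series (fun n => v n y)) b a) by ring.
  eapply is_series_ext; [|exact H]. intros n.
  rewrite <- (opp_RInt_swap (V := R_CompleteNormedModule) (v n) b a)
    by (apply ex_RInt_continuous_global, Hc).
  change (-1 * RInt (v n) b a = - RInt (v n) b a). ring.
Qed.

(** Termwise integration of [v] from 0 gives [u n y - u n 0], so the sum of the [u n] is a constant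
    plus the integral of a continuous function. Only the derivatives need domination; pointwise
    convergence is enough for [u]. *)
Lemma is_derive_Series (u v : nat -> R -> R) (x : R) :
  (forall n y, is_derive (u n) y (v n y)) -> (forall n y, continuous (v n) y) ->
  locally_dominated v -> (forall y, ex_series (fun n => u n y)) ->
  is_derive (fun y => Series (fun n => u n y)) x (Series (fun n => v n x)).
Proof.
  intros Hu Hc Hd Hs.
  assert (HC : forall y, continuous (fun y => Series (fun n => v n y)) y).
  { intros y; apply Series_continuous; assumption. }
  apply is_derive_ext with
    (fun y => plus (Series (fun n => u n 0)) (RInt (fun y => Series (fun n => v n y)) 0 y)).
  - intros y. pose proof (is_series_RInt v 0 y Hc Hd) as H. apply is_series_unique in H.
    rewrite <- H.
    rewrite (Series_ext (fun n => RInt (v n) 0 y) (fun n => u n y - u n 0)).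
    + rewrite Series_minus; auto. apply Rplus_minus.
    + intros n. apply is_RInt_unique.
      apply (is_RInt_derive (u n) (v n) 0 y); intros; [apply Hu | apply Hc].
  - replace (Series (fun n => v n x)) with (plus 0 (Series (fun n => v n x)))
      by (exact (Rplus_0_l _)).
    apply (is_derive_plus (V := R_NormedModule)).
    + apply (is_derive_const (V := R_NormedModule)).
    + apply (is_derive_RInt (V := R_NormedModule) (fun y => Series (fun n => v n y)) _ 0 x).
      * apply filter_forall. intros y.
        apply (RInt_correct (V := R_CompleteNormedModule)). apply ex_RInt_continuous_global, HC.
      * apply HC.
Qed.

(** * Completeness of the cosines on the unit interval *)

Definition cos_orthogonal (f : R -> R) : Prop :=
  (forall y, continuous f y) /\
  forall n, is_RInt (fun y => f y * cos (INR n * PI * y)) 0 1 0.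

Lemma cos_orthogonal_ext (f g : R -> R) :
  (forall y, f y = g y) -> cos_orthogonal f -> cos_orthogonal g.
Proof.
  intros E [H1 H2]. split.
  - intros y. apply continuous_ext with f; auto.
  - intros n. apply (is_RInt_ext (fun y => f y * cos (INR n * PI * y))); auto.
    intros y _. rewrite E. reflexivity.
Qed.

Lemma cos_orthogonal_lin (f g : R -> R) (a b : R) :
  cos_orthogonal f -> cos_orthogonal g -> cos_orthogonal (fun y => a * f y + b * g y).
Proof.
  intros [F1 F2] [G1 G2]. split.
  - intros y. apply (continuous_plus (V := R_NormedModule)).
    + apply (continuous_scal_r (V := R_NormedModule) a f), F1.
    + apply (continuous_scal_r (V := R_NormedModule) b g), G1.
  - intros n.
    apply (is_RInt_ext (fun y => plus (scal a (f y * cos (INR n * PI * y)))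
                                      (scal b (g y * cos (INR n * PI * y))))).
    + intros y _.
      change (a * (f y * cos (INR n * PI * y)) + b * (g y * cos (INR n * PI * y))
              = (a * f y + b * g y) * cos (INR n * PI * y)). ring.
    + replace 0 with (plus (scal a 0) (scal b 0)) at 2
        by (change (a * 0 + b * 0 = 0); ring).
      apply (is_RInt_plus (V := R_NormedModule)); apply (is_RInt_scal (V := R_NormedModule)); auto.
Qed.

Lemma continuous_cos_lin (a y : R) : continuous (fun y => cos (a * y)) y.
Proof.
  apply is_derive_continuous with (- (a * sin (a * y))). auto_derive; auto; ring.
Qed.

(** The product of [cos (PI * y)] with the cosine of index [n] is half the sum of the cosines of
    indices [n + 1] and [n - 1]; at [n = 0] it is the cosine of index 1. Hence orthogonality
    survives multiplication by any polynomial in [cos (PI * y)]. *)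
Lemma cos_orthogonal_mul_cos (f : R -> R) :
  cos_orthogonal f -> cos_orthogonal (fun y => f y * cos (PI * y)).
Proof.
  intros [F1 F2]. split.
  - intros y. apply (continuous_mult (K := R_AbsRing) f (fun y => cos (PI * y))).
    + apply F1.
    + apply continuous_cos_lin.
  - intros n. destruct n as [|n].
    + apply (is_RInt_ext (fun y => f y * cos (INR 1 * PI * y))); [|apply F2].
      intros y _. change (INR 0) with 0. change (INR 1) with 1. rewrite (Rmult_0_l PI), Rmult_0_l, cos_0, Rmult_1_r, Rmult_1_l. reflexivity.
    + apply (is_RInt_ext (fun y => plus (scal (/ 2) (f y * cos (INR (S (S n)) * PI * y)))
                                        (scal (/ 2) (f y * cos (INR n * PI * y))))).
      * intros y _.
        change (/ 2 * (f y * cos (INR (S (S n)) * PI * y)) + / 2 * (f y * cos (INR n * PI * y))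
              = f y * cos (PI * y) * cos (INR (S n) * PI * y)).
        replace (INR (S (S n)) * PI * y) with (INR (S n) * PI * y + PI * y)
          by (rewrite (S_INR (S n)); ring).
        replace (INR n * PI * y) with (INR (S n) * PI * y - PI * y)
          by (rewrite (S_INR n); ring).
        rewrite cos_plus, cos_minus. field.
      * replace 0 with (plus (scal (/ 2) 0) (scal (/ 2) 0)) at 2
          by (change (/ 2 * 0 + / 2 * 0 = 0); ring).
        apply (is_RInt_plus (V := R_NormedModule)); apply (is_RInt_scal (V := R_NormedModule)); auto.
Qed.

(** The powers of this trigonometric polynomial concentrate on [a <= y <= b]. *)
Definition cos_kernel (a b y : R) : R :=
  1 + (cos (PI * a) - cos (PI * y)) * (cos (PI * y) - cos (PI * b)) / 4.

Lemma cos_orthogonal_mul_kernel (f : R -> R) (a b : R) (k : nat) :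
  cos_orthogonal f -> cos_orthogonal (fun y => f y * cos_kernel a b y ^ k).
Proof.
  intros Hf. induction k as [|k IH].
  - apply cos_orthogonal_ext with f; [intros y; simpl; ring | exact Hf].
  - pose proof (cos_orthogonal_mul_cos _ IH) as H1.
    pose proof (cos_orthogonal_mul_cos _ H1) as H2.
    (* The kernel is quadratic in [cos (PI * y)]; these are its constant and linear coefficients,
       and [- / 4] is the quadratic one. *)
    pose proof (cos_orthogonal_lin _ _ (1 - cos (PI * a) * cos (PI * b) / 4)
       ((cos (PI * a) + cos (PI * b)) / 4) IH H1) as H3.
    pose proof (cos_orthogonal_lin _ _ 1 (- / 4) H3 H2) as H4.
    eapply cos_orthogonal_ext; [|exact H4].
    intros y. cbv beta. rewrite <- tech_pow_Rmult. set (P := cos_kernel a b y ^ k). unfold cos_kernel. field.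
Qed.

Lemma cos_PI_le (x y : R) : 0 <= x -> x <= y -> y <= 1 -> cos (PI * y) <= cos (PI * x).
Proof.
  intros H0 H1 H2. pose proof PI_RGT_0.
  apply cos_decr_1; nra.
Qed.

Lemma cos_PI_lt (x y : R) : 0 <= x -> x < y -> y <= 1 -> cos (PI * y) < cos (PI * x).
Proof.
  intros H0 H1 H2. pose proof PI_RGT_0.
  apply cos_decreasing_1; nra.
Qed.

Lemma cos_kernel_ge_1 (a b y : R) : 0 <= a -> a <= y <= b -> b <= 1 -> 1 <= cos_kernel a b y.
Proof.
  intros Ha Hy Hb. unfold cos_kernel.
  assert (cos (PI * y) <= cos (PI * a)) by (apply cos_PI_le; lra).
  assert (cos (PI * b) <= cos (PI * y)) by (apply cos_PI_le; lra).
  assert (0 <= (cos (PI * a) - cos (PI * y)) * (cos (PI * y) - cos (PI * b))).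
  { apply Rmult_le_pos; lra. }
  lra.
Qed.

(** The two differences of cosines have absolute value at most 2, so the divisor 4 in the kernel
    keeps it between 0 and 1 where their product is negative or zero. *)
Lemma cos_kernel_outside (a b y : R) :
  0 <= y <= 1 -> 0 <= a -> a <= b -> b <= 1 -> y <= a \/ b <= y -> Rabs (cos_kernel a b y) <= 1.
Proof.
  intros Hy Ha Hab Hb Ho. unfold cos_kernel.
  pose proof (COS_bound (PI * a)) as Ba. pose proof (COS_bound (PI * b)) as Bb.
  pose proof (COS_bound (PI * y)) as By.
  pose proof (cos_PI_le a b Ha Hab Hb) as Cab.
  assert (Hc : cos (PI * a) <= cos (PI * y) \/ cos (PI * y) <= cos (PI * b)).
  { destruct Ho; [left | right]; apply cos_PI_le; lra. }
  revert Ba Bb By Cab Hc.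
  generalize (cos (PI * a)) (cos (PI * b)) (cos (PI * y)). intros ca cb c Ba Bb By Cab Hc.
  assert (P : 0 <= (c - ca) * (c - cb) <= 4).
  { destruct Hc; split.
    - apply Rmult_le_pos; lra.
    - replace 4 with (2 * 2) by ring. apply Rmult_le_compat; lra.
    - replace ((c - ca) * (c - cb)) with ((ca - c) * (cb - c)) by ring. apply Rmult_le_pos; lra.
    - replace ((c - ca) * (c - cb)) with ((ca - c) * (cb - c)) by ring.
      replace 4 with (2 * 2) by ring. apply Rmult_le_compat; lra. }
  replace ((ca - c) * (c - cb)) with (- ((c - ca) * (c - cb))) by ring.
  apply Rabs_le. lra.
Qed.

Lemma RInt_ge_const (f : R -> R) (a b m : R) :
  (forall y, continuous f y) -> a <= b -> (forall y, a <= y <= b -> m <= f y) ->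
  (b - a) * m <= RInt f a b.
Proof.
  intros Hc Hab Hm.
  replace ((b - a) * m) with (RInt (fun _ => m) a b) by (rewrite RInt_const; reflexivity).
  apply RInt_le; auto.
  - apply ex_RInt_const.
  - apply ex_RInt_continuous_global, Hc.
  - intros y Hy. apply Hm. lra.
Qed.

(** Peaking argument. The integral of [h] against every power of the kernel is 0. Outside [a, b] the
    powers are bounded, so that part loses at most [H]; inside, the integrand is nonnegative, and on
    a smaller interval it grows without bound with the power. *)
Lemma cos_orthogonal_not_pos (h : R -> R) (a b eta : R) :
  cos_orthogonal h -> 0 <= a -> a < b -> b <= 1 -> 0 < eta ->
  (forall y, a <= y <= b -> eta <= h y) -> False.
Proof.
  intros Hh Ha Hab Hb Heta Hpos.
  destruct (continuity_ab_maj (fun y => Rabs (h y)) 0 1) as [ym [Hym _]]; [lra| |].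
  { intros y _. apply continuity_pt_filterlim. apply continuous_Rabs_comp. apply (proj1 Hh). }
  set (H := Rabs (h ym)) in *.
  assert (HH : 0 <= H) by apply Rabs_pos.
  (* The kernel equals 1 at [a] and [b]; a uniform excess over 1 is available only away from them,
     here on the middle third. *)
  set (a' := a + (b - a) / 3). set (b' := a + 2 * (b - a) / 3).
  assert (Ha' : a < a' < b') by (unfold a', b'; lra).
  assert (Hb' : b' < b) by (unfold b'; lra).
  set (mu := (cos (PI * a) - cos (PI * a')) * (cos (PI * b') - cos (PI * b)) / 4).
  assert (Hmu : 0 < mu).
  { unfold mu. assert (cos (PI * a') < cos (PI * a)) by (apply cos_PI_lt; lra).
    assert (cos (PI * b) < cos (PI * b')) by (apply cos_PI_lt; lra).
    apply Rdiv_lt_0_compat; [apply Rmult_lt_0_compat; lra | lra]. }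
  set (D := (b' - a') * eta * mu).
  assert (HD : 0 < D) by (unfold D; apply Rmult_lt_0_compat; [apply Rmult_lt_0_compat; lra | exact Hmu]).
  (* With this power the gain [INR k * D] over the middle third exceeds the largest possible loss
     [H] outside. *)
  destruct (INR_unbounded (H / D)) as [k Hk].
  destruct (cos_orthogonal_mul_kernel h a b k Hh) as [Hc Hz].
  specialize (Hz 0%nat). simpl INR in Hz.
  set (F := fun y => h y * cos_kernel a b y ^ k) in *.
  assert (HF : RInt F 0 1 = 0).
  { apply is_RInt_unique. eapply is_RInt_ext; [|exact Hz].
    intros y _. cbv beta. rewrite !Rmult_0_l, cos_0, Rmult_1_r. reflexivity. }
  assert (Hex : forall u v, ex_RInt F u v) by (intros; apply ex_RInt_continuous_global, Hc).
  rewrite <- (RInt_Chasles F 0 a 1) in HF by apply Hex.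
  rewrite <- (RInt_Chasles F a a' 1) in HF by apply Hex.
  rewrite <- (RInt_Chasles F a' b' 1) in HF by apply Hex.
  rewrite <- (RInt_Chasles F b' b 1) in HF by apply Hex.
  change (RInt F 0 a + (RInt F a a' + (RInt F a' b' + (RInt F b' b + RInt F b 1))) = 0) in HF.
  assert (Hout : forall y, 0 <= y <= 1 -> y <= a \/ b <= y -> - H <= F y).
  { intros y Hy Ho. unfold F.
    assert (Rabs (h y * cos_kernel a b y ^ k) <= H * 1).
    { rewrite Rabs_mult. apply Rmult_le_compat; try apply Rabs_pos.
      - apply (Hym y Hy).
      - rewrite <- RPow_abs. rewrite <- (pow1 k).
        apply pow_incr. split; [apply Rabs_pos|]. apply cos_kernel_outside; lra. }
    apply Rabs_le_between in H0. lra. }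
  assert (I1 : (a - 0) * - H <= RInt F 0 a).
  { apply RInt_ge_const; auto. intros; apply Hout; lra. }
  assert (I5 : (1 - b) * - H <= RInt F b 1).
  { apply RInt_ge_const; auto. intros; apply Hout; lra. }
  assert (Hin : forall y, a <= y <= b -> 0 <= F y).
  { intros y Hy. unfold F. apply Rmult_le_pos.
    - apply Rle_trans with eta; [lra | apply Hpos, Hy].
    - apply pow_le. pose proof (cos_kernel_ge_1 a b y Ha Hy Hb). lra. }
  assert (I2 : (a' - a) * 0 <= RInt F a a').
  { apply RInt_ge_const; auto; [lra|]. intros; apply Hin; lra. }
  assert (I4 : (b - b') * 0 <= RInt F b' b).
  { apply RInt_ge_const; auto; [lra|]. intros; apply Hin; lra. }
  assert (I3 : (b' - a') * (eta * (1 + INR k * mu)) <= RInt F a' b').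
  { apply RInt_ge_const; auto; [lra|]. intros y Hy. unfold F.
    apply Rmult_le_compat.
    - lra.
    - pose proof (pos_INR k). nra.
    - apply Hpos; lra.
    (* [poly] is Bernoulli's inequality: linear growth in [k] already suffices. *)
    - apply Rle_trans with ((1 + mu) ^ k); [apply poly; lra|].
      apply pow_incr. split; [lra|]. unfold cos_kernel, mu.
      assert (cos (PI * y) <= cos (PI * a')) by (apply cos_PI_le; lra).
      assert (cos (PI * b') <= cos (PI * y)) by (apply cos_PI_le; lra).
      assert (cos (PI * a') < cos (PI * a)) by (apply cos_PI_lt; lra).
    assert (cos (PI * b) < cos (PI * b')) by (apply cos_PI_lt; lra).
      assert ((cos (PI * a) - cos (PI * a')) * (cos (PI * b') - cos (PI * b))
              <= (cos (PI * a) - cos (PI * y)) * (cos (PI * y) - cos (PI * b))).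
      { apply Rmult_le_compat; lra. }
      lra. }
  assert (Hk' : H < INR k * D).
  { apply Rmult_lt_reg_r with (/ D); [apply Rinv_0_lt_compat; lra|].
    replace (INR k * D * / D) with (INR k) by (field; lra). exact Hk. }
  assert (E : (b' - a') * (eta * (1 + INR k * mu)) = (b' - a') * eta + INR k * D)
    by (unfold D; ring).
  assert (0 < (b' - a') * eta) by (apply Rmult_lt_0_compat; lra).
  rewrite E in I3.
  assert (a * H <= H) by nra.
  nra.
Qed.

Lemma cos_orthogonal_eq_0 (h : R -> R) (y : R) :
  cos_orthogonal h -> 0 <= y <= 1 -> h y = 0.
Proof.
  assert (key : forall h y, cos_orthogonal h -> 0 <= y <= 1 -> ~ 0 < h y).
  { clear. intros h y Hh Hy Hp.
    pose proof (proj1 (filterlim_locally _ _) (proj1 Hh y)) as Hc.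
    assert (He : 0 < h y / 2) by lra.
    destruct (Hc (mkposreal _ He)) as [d Hd].
    assert (Hd' : forall z, Rabs (z - y) < d -> h y / 2 <= h z).
    { intros z Hz. specialize (Hd z Hz). change (Rabs (h z - h y) < h y / 2) in Hd.
      apply Rabs_def2 in Hd. lra. }
    set (s := Rmin (d / 2) (1 / 2)).
    pose proof (cond_pos d).
    assert (Hs : 0 < s) by (unfold s; apply Rmin_pos; lra).
    assert (Hs1 : s <= d / 2) by apply Rmin_l.
    assert (Hs2 : s <= 1 / 2) by apply Rmin_r.
    (* A one-sided interval of length at most 1/2, directed towards the middle, stays in [0, 1] even
       when [y] is an end point. *)
    destruct (Rle_dec y (1 / 2)).
    - apply (cos_orthogonal_not_pos h y (y + s) (h y / 2)); auto; try lra.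
      intros z Hz. apply Hd'. apply Rabs_def1; lra.
    - apply (cos_orthogonal_not_pos h (y - s) y (h y / 2)); auto; try lra.
      intros z Hz. apply Hd'. apply Rabs_def1; lra. }
  intros Hh Hy. destruct (Rtotal_order (h y) 0) as [H|[H|H]]; [|exact H|].
  - exfalso. apply (key (fun y => (-1) * h y + 0 * h y) y); auto; [|lra].
    apply cos_orthogonal_lin; exact Hh.
  - exfalso. apply (key h y); auto.
Qed.

(** * The theta function and its cosine coefficients *)

Lemma is_RInt_eq (f g : R -> R) (a b l m : R) :
  is_RInt f a b l -> (forall y, f y = g y) -> l = m -> is_RInt g a b m.
Proof.
  intros H E <-. apply is_RInt_ext with f; [intros y _; apply E | exact H].
Qed.

Lemma exp_nondecreasing (x y : R) : x <= y -> exp x <= exp y.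
Proof. intros [H| ->]; [left; apply exp_increasing, H | apply Rle_refl]. Qed.

Lemma pow_le_fact_exp (x : R) (j : nat) : 0 <= x -> x ^ j <= INR (Factorial.fact j) * exp x.
Proof.
  intros Hx. pose proof (exp_ge_taylor x j Hx) as H.
  assert (Hf : 0 < INR (Factorial.fact j)) by apply INR_fact_lt_0.
  assert (Hj : x ^ j / INR (Factorial.fact j) <= sum_f_R0 (fun k => x ^ k / INR (Factorial.fact k)) j).
  { destruct j as [|j]; [simpl; lra|]. rewrite tech5.
    assert (0 <= sum_f_R0 (fun k => x ^ k / INR (Factorial.fact k)) j); [|lra].
    apply cond_pos_sum. intros k. apply Rdiv_le_0_compat; [apply pow_le, Hx | apply INR_fact_lt_0]. }
  replace (x ^ j) with (INR (Factorial.fact j) * (x ^ j / INR (Factorial.fact j))) by (field; lra).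
  apply Rmult_le_compat_l; lra.
Qed.

Lemma exp_pow_INR (x : R) (n : nat) : exp x ^ n = exp (INR n * x).
Proof.
  induction n as [|n IH]; [simpl; rewrite Rmult_0_l, exp_0; reflexivity|].
  rewrite S_INR, <- tech_pow_Rmult, IH, <- exp_plus. f_equal. ring.
Qed.

Lemma ex_series_gaussian (j : nat) (a s : R) :
  0 < a -> ex_series (fun n => INR (S n) ^ j * exp (- (a * INR (S n) ^ 2) + s * INR (S n))).
Proof.
  intros Ha.
  (* Completing the square bounds [- a * x ^ 2 + (s + 2) * x]. Of the 2 added to [s], one unit pays
     for the power, through [x ^ j <= j! * exp x], and the other leaves the geometric factor
     [exp (- x)]. *)
  set (K := INR (Factorial.fact j) * exp ((s + 2) ^ 2 / (4 * a))).
  apply (ex_series_le (K := R_AbsRing) (V := R_CompleteNormedModule) _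
           (fun n => scal (K * exp (-1)) (exp (-1) ^ n))).
  - intros n. change norm with Rabs. change scal with Rmult.
    set (x := INR (S n)). assert (Hx : 0 <= x) by apply pos_INR.
    rewrite Rabs_pos_eq by (apply Rmult_le_pos; [apply pow_le, Hx | left; apply exp_pos]).
    rewrite Rmult_assoc, tech_pow_Rmult, exp_pow_INR. fold x.
    apply Rle_trans with (INR (Factorial.fact j) * exp x * exp (- (a * x ^ 2) + s * x)).
    + apply Rmult_le_compat_r; [left; apply exp_pos | apply pow_le_fact_exp, Hx].
    + unfold K. rewrite !Rmult_assoc. apply Rmult_le_compat_l; [apply pos_INR|].
      rewrite <- !exp_plus. apply exp_nondecreasing.
      assert (0 <= (2 * a * x - (s + 2)) ^ 2 / (4 * a)).
      { apply Rdiv_le_0_compat; [apply pow2_ge_0 | lra]. }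
      replace ((2 * a * x - (s + 2)) ^ 2 / (4 * a))
        with (a * x ^ 2 - (s + 2) * x + (s + 2) ^ 2 / (4 * a)) in H by (field; lra).
      lra.
  - apply (ex_series_scal (V := R_NormedModule)). apply ex_series_geom.
    rewrite Rabs_pos_eq by (left; apply exp_pos).
    rewrite <- exp_0. apply exp_increasing. lra.
Qed.

Definition theta_term (c : R) (n : nat) (y : R) : R :=
  cos (INR (S n) * PI * y) * exp (- (INR (S n) ^ 2 * PI ^ 2 * c)).

(** The [y]-derivative of [phi]: Jacobi's third theta function with nome [exp (- (PI ^ 2 * c))], at
    the argument [PI * y / 2]. *)
Definition theta (c y : R) : R := 1 + 2 * Series (fun n => theta_term c n y).

(** The trivial factors on the right put the majorant in the form summed by [ex_series_gaussian]. *)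
Lemma theta_term_bound (c : R) (n : nat) (y : R) :
  Rabs (theta_term c n y) <= INR (S n) ^ 0 * exp (- (PI ^ 2 * c * INR (S n) ^ 2) + 0 * INR (S n)).
Proof.
  unfold theta_term. rewrite Rabs_mult, (Rabs_pos_eq (exp _)) by (left; apply exp_pos).
  rewrite pow_O. apply Rmult_le_compat; try apply Rabs_pos.
  - left; apply exp_pos.
  - apply Rabs_le, COS_bound.
  - right. f_equal. ring.
Qed.

Lemma PI2_mult_pos (c : R) : 0 < c -> 0 < PI ^ 2 * c.
Proof. intros Hc. apply Rmult_lt_0_compat; [apply pow_lt, PI_RGT_0 | exact Hc]. Qed.

Lemma theta_term_dominated (c : R) : 0 < c -> locally_dominated (theta_term c).
Proof.
  intros Hc r. eexists. split; [|intros n y _; apply theta_term_bound].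
  apply ex_series_gaussian. apply PI2_mult_pos, Hc.
Qed.

Lemma theta_term_continuous (c : R) (n : nat) (y : R) : continuous (theta_term c n) y.
Proof.
  unfold theta_term. apply (continuous_mult (K := R_AbsRing)).
  - apply (continuous_cos_lin (INR (S n) * PI)).
  - apply continuous_const.
Qed.

Lemma theta_continuous (c y : R) : 0 < c -> continuous (theta c) y.
Proof.
  intros Hc. apply (continuous_plus (V := R_NormedModule)); [apply continuous_const|].
  apply (continuous_scal_r (V := R_NormedModule) 2).
  apply Series_continuous; [apply theta_term_continuous | apply theta_term_dominated, Hc].
Qed.

Lemma ex_series_phi_term (c y : R) : 0 < c -> ex_series (fun n => phi_term y c (S n)).
Proof.
  intros Hc. eapply (ex_series_le (K := R_AbsRing) (V := R_CompleteNormedModule));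
    [|apply (ex_series_gaussian 0 _ 0 (PI2_mult_pos c Hc))].
  intros n. change norm with Rabs. unfold phi_term.
  assert (Hn : 1 <= INR (S n)) by (rewrite S_INR; pose proof (pos_INR n); lra).
  rewrite Rabs_mult, (Rabs_pos_eq (exp _)) by (left; apply exp_pos). rewrite pow_O.
  apply Rmult_le_compat; try apply Rabs_pos.
  - left; apply exp_pos.
  - unfold Rdiv. rewrite Rabs_mult. rewrite <- (Rmult_1_l 1).
    apply Rmult_le_compat; try apply Rabs_pos.
    + apply Rabs_le, SIN_bound.
    + rewrite Rabs_pos_eq by (left; apply Rinv_0_lt_compat; lra).
      rewrite <- Rinv_1. apply Rinv_le_contravar; lra.
  - right. f_equal. ring.
Qed.

Lemma is_derive_phi (c y : R) : 0 < c -> is_derive (fun z => phi z c) y (theta c y).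
Proof.
  intros Hc. unfold phi, theta. pose proof PI_RGT_0.
  replace (1 + 2 * Series (fun n => theta_term c n y))
    with (plus 1 (scal (2 / PI) (Series (fun n => PI * theta_term c n y)))).
  2:{ rewrite Series_scal_l.
      change (1 + 2 / PI * (PI * Series (fun n => theta_term c n y))
              = 1 + 2 * Series (fun n => theta_term c n y)). field. lra. }
  apply (is_derive_plus (V := R_NormedModule)); [apply (is_derive_id (K := R_AbsRing))|].
  apply (is_derive_scal (fun z => Series (fun n => phi_term z c (S n)))).
  apply (is_derive_Series (fun n z => phi_term z c (S n)) (fun n z => PI * theta_term c n z)).
  - intros n z. unfold phi_term, theta_term.
    assert (H0 : INR (S n) <> 0) by (apply not_0_INR; lia).
    revert H0. generalize (INR (S n)) (exp (- (INR (S n) ^ 2 * PI ^ 2 * c))). intros x e H0.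
    auto_derive; [exact I|]. field. assumption.
  - intros n z. apply (continuous_scal_r (V := R_NormedModule) PI), theta_term_continuous.
  - intros r. destruct (theta_term_dominated c Hc r) as [B [HB HT]].
    exists (fun n => PI * B n). split.
    + apply (ex_series_scal (V := R_NormedModule) PI), HB.
    + intros n z Hz. rewrite Rabs_mult, Rabs_pos_eq by lra.
      apply Rmult_le_compat_l; [lra | apply HT, Hz].
  - intros z. apply ex_series_phi_term, Hc.
Qed.

Lemma is_RInt_cos_int (z : Z) : z <> 0%Z -> is_RInt (fun y => cos (IZR z * PI * y)) 0 1 0.
Proof.
  intros Hz. pose proof PI_RGT_0. apply not_0_IZR in Hz.
  replace 0 with (minus (sin (IZR z * PI * 1) / (IZR z * PI)) (sin (IZR z * PI * 0) / (IZR z * PI))) at 2.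
  - apply (is_RInt_derive (V := R_CompleteNormedModule)
             (fun y => sin (IZR z * PI * y) / (IZR z * PI)) (fun y => cos (IZR z * PI * y))).
    + intros y _. auto_derive; [exact I|]. field. split; lra.
    + intros y _. apply continuous_cos_lin.
  - change (sin (IZR z * PI * 1) / (IZR z * PI) - sin (IZR z * PI * 0) / (IZR z * PI) = 0).
    rewrite Rmult_1_r, Rmult_0_r, sin_0, (sin_eq_0_1 (IZR z * PI)) by (exists z; reflexivity).
    field. split; lra.
Qed.

Lemma RInt_cos_cos (k n : nat) :
  RInt (fun y => cos (INR (S k) * PI * y) * cos (INR n * PI * y)) 0 1
    = if Nat.eq_dec (S k) n then 1 / 2 else 0.
Proof.
  apply is_RInt_unique.
  assert (H1 : is_RInt (fun y => cos (IZR (Z.of_nat (S k) + Z.of_nat n) * PI * y)) 0 1 0)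
    by (apply is_RInt_cos_int; lia).
  assert (H2 : is_RInt (fun y => cos (IZR (Z.of_nat (S k) - Z.of_nat n) * PI * y)) 0 1
                 (if Nat.eq_dec (S k) n then 1 else 0)).
  { destruct (Nat.eq_dec (S k) n) as [E|E]; [|apply is_RInt_cos_int; lia].
    rewrite <- E, Z.sub_diag.
    replace 1 with (scal (1 - 0) 1) at 2 by (change ((1 - 0) * 1 = 1); ring).
    apply is_RInt_ext with (fun _ => 1).
    - intros y _. rewrite !Rmult_0_l, cos_0. reflexivity.
    - apply (is_RInt_const (V := R_NormedModule)). }
  pose proof (is_RInt_scal _ _ _ (1 / 2) _ (is_RInt_plus _ _ _ _ _ _ H1 H2)) as H3.
  eapply is_RInt_eq; [exact H3 | |].
  - intros y. cbv beta.
    rewrite plus_IZR, minus_IZR, <- !INR_IZR_INZ.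
    replace ((INR (S k) + INR n) * PI * y) with (INR (S k) * PI * y + INR n * PI * y) by ring.
    replace ((INR (S k) - INR n) * PI * y) with (INR (S k) * PI * y - INR n * PI * y) by ring.
    rewrite cos_plus, cos_minus.
    match goal with |- scal _ (plus ?u ?v) = ?r => change (1 / 2 * (u + v) = r) end.
    field.
  - destruct (Nat.eq_dec (S k) n).
    + change (1 / 2 * (0 + 1) = 1 / 2). field.
    + change (1 / 2 * (0 + 0) = 0). field.
Qed.

Lemma Series_single (a : nat -> R) (m : nat) :
  (forall k, k <> m -> a k = 0) -> Series a = a m.
Proof.
  intros H. apply is_series_unique.
  assert (Hz : forall n, (n < m)%nat -> sum_n a n = 0).
  { induction n as [|n IH]; intros Hn; [rewrite sum_O; apply H; lia|].
    rewrite sum_Sn, IH, H by lia. apply Rplus_0_l. }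
  assert (Hs : forall n, (m <= n)%nat -> sum_n a n = a m).
  { intros n Hn. induction Hn as [|n Hn IH].
    - destruct m as [|m]; [apply sum_O|]. rewrite sum_Sn, Hz by lia. apply Rplus_0_l.
    - rewrite sum_Sn, IH, (H (S n)) by lia. apply Rplus_0_r. }
  apply (is_lim_seq_ext_loc (fun _ => a m) (sum_n a) (a m)); [|apply is_lim_seq_const].
  exists m. intros n Hn. symmetry. apply Hs, Hn.
Qed.

Lemma Series_nonneg (a : nat -> R) :
  ex_series a -> (forall n, 0 <= a n) -> 0 <= Series a.
Proof.
  intros Ha H.
  replace 0 with (Series (fun _ : nat => 0)) by (apply (Series_single (fun _ => 0) 0); reflexivity).
  apply Series_le; [|exact Ha]. intros n; split; [lra | apply H].
Qed.

Lemma dominated_mul_cos (v : nat -> R -> R) (w : R) :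
  locally_dominated v -> locally_dominated (fun k y => v k y * cos (w * y)).
Proof.
  intros Hv r. destruct (Hv r) as [B [HB HV]]. exists B. split; [exact HB|].
  intros n y Hy. rewrite Rabs_mult. rewrite <- (Rmult_1_r (B n)).
  apply Rmult_le_compat; try apply Rabs_pos; [apply HV, Hy|].
  apply Rabs_le, COS_bound.
Qed.

Lemma is_series_cos_coef (v : nat -> R -> R) (w : R) :
  (forall n y, continuous (v n) y) -> locally_dominated v ->
  is_series (fun k => RInt (fun y => v k y * cos (w * y)) 0 1)
    (RInt (fun y => Series (fun k => v k y) * cos (w * y)) 0 1).
Proof.
  intros Hc Hd.
  replace (RInt (fun y => Series (fun k => v k y) * cos (w * y)) 0 1)
    with (RInt (fun y => Series (fun k => v k y * cos (w * y))) 0 1).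
  - apply (is_series_RInt (fun k y => v k y * cos (w * y))).
    + intros n y. apply (continuous_mult (K := R_AbsRing)); [apply Hc | apply continuous_cos_lin].
    + apply dominated_mul_cos, Hd.
  - apply RInt_ext. intros y _. apply Series_scal_r.
Qed.

(** The factor 2 in [theta] compensates the mean value 1/2 of a squared cosine, so that one formula
    covers both [n = 0], where only the constant term contributes, and [n >= 1], where only the term
    of index [n] does. *)
Lemma is_RInt_theta_cos (c : R) (n : nat) :
  0 < c ->
  is_RInt (fun y => theta c y * cos (INR n * PI * y)) 0 1 (exp (- (INR n ^ 2 * PI ^ 2 * c))).
Proof.
  intros Hc. set (w := INR n * PI).
  assert (H1 : is_RInt (fun y => cos (w * y)) 0 1 (if Nat.eq_dec n 0 then 1 else 0)).
  { unfold w. destruct (Nat.eq_dec n 0) as [E|E].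
    - rewrite E. replace 1 with (scal (1 - 0) 1) at 2 by (change ((1 - 0) * 1 = 1); ring).
      apply is_RInt_ext with (fun _ => 1).
      + intros y _. change (INR 0) with 0. rewrite !Rmult_0_l, cos_0. reflexivity.
      + apply (is_RInt_const (V := R_NormedModule)).
    - rewrite INR_IZR_INZ. apply is_RInt_cos_int. lia. }
  assert (H2 : is_RInt (fun y => Series (fun k => theta_term c k y) * cos (w * y)) 0 1
                 (RInt (fun y => Series (fun k => theta_term c k y) * cos (w * y)) 0 1)).
  { apply (RInt_correct (V := R_CompleteNormedModule)), ex_RInt_continuous_global. intros y.
    apply (continuous_mult (K := R_AbsRing)); [|apply continuous_cos_lin].
    apply Series_continuous; [apply theta_term_continuous | apply theta_term_dominated, Hc]. }
  pose proof (is_series_cos_coef (theta_term c) w (theta_term_continuous c)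
                (theta_term_dominated c Hc)) as HS.
  apply is_series_unique in HS.
  assert (Hk : forall k, RInt (fun y => theta_term c k y * cos (w * y)) 0 1
             = if Nat.eq_dec (S k) n then exp (- (INR n ^ 2 * PI ^ 2 * c)) / 2 else 0).
  { intros k.
    assert (Hx : ex_RInt (fun y => cos (INR (S k) * PI * y) * cos (INR n * PI * y)) 0 1).
    { apply ex_RInt_continuous_global. intros y.
      apply (continuous_mult (K := R_AbsRing)); apply continuous_cos_lin. }
    apply is_RInt_unique.
    eapply is_RInt_eq.
    - exact (is_RInt_scal (V := R_NormedModule) _ 0 1 (exp (- (INR (S k) ^ 2 * PI ^ 2 * c))) _
               (RInt_correct (V := R_CompleteNormedModule) _ _ _ Hx)).
    - intros y. unfold theta_term, w. change (scal (V := R_NormedModule)) with Rmult. cbv beta. ring.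
    - rewrite RInt_cos_cos. change (scal (V := R_NormedModule)) with Rmult.
      destruct (Nat.eq_dec (S k) n) as [E|E].
      + rewrite E. unfold Rdiv. rewrite Rmult_1_l. reflexivity.
      + apply Rmult_0_r. }
  assert (HS' : RInt (fun y => Series (fun k => theta_term c k y) * cos (w * y)) 0 1
                = if Nat.eq_dec n 0 then 0 else exp (- (INR n ^ 2 * PI ^ 2 * c)) / 2).
  { rewrite <- HS, (Series_ext _ _ Hk). destruct n as [|m]; simpl (Nat.eq_dec _ 0).
    - rewrite (Series_single _ 0); reflexivity.
    - rewrite (Series_single _ m).
      + destruct (Nat.eq_dec (S m) (S m)); [|lia]. destruct (Nat.eq_dec (S m) 0); [lia|reflexivity].
      + intros k Hkm. destruct (Nat.eq_dec (S k) (S m)); [lia|reflexivity]. }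
  rewrite HS' in H2.
  pose proof (is_RInt_plus _ _ _ _ _ _ H1 (is_RInt_scal _ _ _ 2 _ H2)) as H3.
  eapply is_RInt_eq; [exact H3 | |].
  - intros y. unfold theta. cbv beta.
    match goal with |- plus ?u (scal _ ?v) = ?r => change (u + 2 * v = r) end.
    ring.
  - destruct (Nat.eq_dec n 0) as [E|E].
    + rewrite E. change (1 + 2 * 0 = exp (- (0 ^ 2 * PI ^ 2 * c))).
      replace (- (0 ^ 2 * PI ^ 2 * c)) with 0 by ring. rewrite exp_0. ring.
    + change (0 + 2 * (exp (- (INR n ^ 2 * PI ^ 2 * c)) / 2) = exp (- (INR n ^ 2 * PI ^ 2 * c))).
      field.
Qed.

(** * Sums of Gaussian images *)

(** Images at opposite centres are paired so that the sum runs over natural numbers. The spacing 2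
    is the common period of the cosines [cos (INR n * PI * y)]. *)
Definition image_term (a : R) (n : nat) (y : R) : R :=
  exp (- (a * (y - 2 * INR (S n)) ^ 2)) + exp (- (a * (y + 2 * INR (S n)) ^ 2)).

Definition image_sum (a y : R) : R :=
  exp (- (a * y ^ 2)) + Series (fun n => image_term a n y).

Lemma image_term_dominated (a : R) : 0 < a -> locally_dominated (image_term a).
Proof.
  intros Ha r.
  exists (fun n => 2 * (INR (S n) ^ 0 * exp (- (4 * a * INR (S n) ^ 2) + 4 * a * r * INR (S n)))).
  split.
  - apply (ex_series_scal (V := R_NormedModule) 2). apply ex_series_gaussian. lra.
  - intros n y Hy. unfold image_term. set (m := INR (S n)).
    assert (Hm : 0 <= m) by apply pos_INR. apply Rabs_le_between in Hy.
    rewrite Rabs_pos_eq by (left; apply Rplus_lt_0_compat; apply exp_pos).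
    rewrite pow_O, Rmult_1_l.
    assert (0 <= a * y ^ 2) by (apply Rmult_le_pos; [lra | apply pow2_ge_0]).
    assert (0 <= a * m) by (apply Rmult_le_pos; lra).
    assert (exp (- (a * (y - 2 * m) ^ 2)) <= exp (- (4 * a * m ^ 2) + 4 * a * r * m)).
    { apply exp_nondecreasing.
      replace (- (a * (y - 2 * m) ^ 2)) with (- (a * y ^ 2) - 4 * a * m ^ 2 + 4 * (a * m) * y) by ring.
      replace (4 * a * r * m) with (4 * (a * m) * r) by ring.
      assert ((a * m) * y <= (a * m) * r) by (apply Rmult_le_compat_l; lra). lra. }
    assert (exp (- (a * (y + 2 * m) ^ 2)) <= exp (- (4 * a * m ^ 2) + 4 * a * r * m)).
    { apply exp_nondecreasing.
      replace (- (a * (y + 2 * m) ^ 2)) with (- (a * y ^ 2) - 4 * a * m ^ 2 + 4 * (a * m) * (- y)) by ring.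
      replace (4 * a * r * m) with (4 * (a * m) * r) by ring.
      assert ((a * m) * (- y) <= (a * m) * r) by (apply Rmult_le_compat_l; lra). lra. }
    lra.
Qed.

Lemma image_term_continuous (a : R) (n : nat) (y : R) : continuous (image_term a n) y.
Proof.
  apply (ex_derive_continuous (V := R_NormedModule)). unfold image_term.
  auto_derive. exact I.
Qed.

Lemma gauss_continuous (a y : R) : continuous (fun y => exp (- (a * y ^ 2))) y.
Proof. apply (ex_derive_continuous (V := R_NormedModule)). auto_derive. exact I. Qed.

Lemma image_sum_continuous (a y : R) : 0 < a -> continuous (image_sum a) y.
Proof.
  intros Ha. apply (continuous_plus (V := R_NormedModule)); [apply gauss_continuous|].
  apply Series_continuous; [apply image_term_continuous | apply image_term_dominated, Ha].
Qed.

Lemma gauss_cos_continuous (a w y : R) : continuous (fun y => exp (- (a * y ^ 2)) * cos (w * y)) y.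
Proof.
  apply (continuous_mult (K := R_AbsRing)); [apply gauss_continuous | apply continuous_cos_lin].
Qed.

(** The maps [y -> 2 * m - y] and [y -> 2 * m + y] carry [0, 1] onto the two halves of the interval
    on the right, and the cosine is invariant under both. The reflection keeps both images of the
    pair on the positive half-line. *)
Lemma RInt_image_cos (a : R) (k n : nat) :
  RInt (fun y => image_term a k y * cos (INR n * PI * y)) 0 1
    = RInt (fun y => exp (- (a * y ^ 2)) * cos (INR n * PI * y)) (2 * INR (S k) - 1) (2 * INR (S k) + 1).
Proof.
  set (m := INR (S k)). set (f := fun y => exp (- (a * y ^ 2)) * cos (INR n * PI * y)).
  assert (Hex : forall u v, is_RInt f u v (RInt f u v)).
  { intros u v. apply (RInt_correct (V := R_CompleteNormedModule)), ex_RInt_continuous_global.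
    apply gauss_cos_continuous. }
  pose proof (Hex (-1 * 0 + 2 * m) (-1 * 1 + 2 * m)) as H1.
  apply (is_RInt_comp_lin (V := R_NormedModule)) in H1.
  pose proof (Hex (1 * 0 + 2 * m) (1 * 1 + 2 * m)) as H2.
  apply (is_RInt_comp_lin (V := R_NormedModule)) in H2.
  pose proof (is_RInt_minus _ _ _ _ _ _ H2 H1) as H3.
  apply is_RInt_unique. eapply is_RInt_eq; [exact H3 | |].
  - intros y. change (scal (V := R_NormedModule)) with Rmult.
    cbv beta; match goal with |- minus ?u ?v = ?r => change (u - v = r) end.
    assert (HP : forall z, cos (INR n * PI * (z + 2 * m)) = cos (INR n * PI * z)).
    { intros z. replace (INR n * PI * (z + 2 * m)) with (INR n * PI * z + 2 * INR (n * S k) * PI).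
      - apply cos_period.
      - rewrite mult_INR. fold m. ring. }
    unfold f, image_term. rewrite !HP. fold m.
    replace (INR n * PI * (-1 * y)) with (- (INR n * PI * y)) by ring. rewrite cos_neg.
    replace (1 * y) with y by ring.
    replace ((-1 * y + 2 * m) ^ 2) with ((y - 2 * m) ^ 2) by ring. ring.
  - change (RInt f (1 * 0 + 2 * m) (1 * 1 + 2 * m) - RInt f (-1 * 0 + 2 * m) (-1 * 1 + 2 * m)
      = RInt f (2 * m - 1) (2 * m + 1)).
    replace (1 * 0 + 2 * m) with (2 * m) by ring. replace (-1 * 0 + 2 * m) with (2 * m) by ring.
    replace (1 * 1 + 2 * m) with (2 * m + 1) by ring. replace (-1 * 1 + 2 * m) with (2 * m - 1) by ring.
    symmetry. apply is_RInt_unique.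
    eapply is_RInt_eq;
      [exact (is_RInt_Chasles _ _ _ _ _ _ (is_RInt_swap _ _ _ _ (Hex (2 * m) (2 * m - 1))) (Hex (2 * m) (2 * m + 1)))
      | reflexivity |].
    cbv beta; match goal with |- plus (opp ?u) ?v = ?r => change (- u + v = r) end. ring.
Qed.

(** The intervals from [RInt_image_cos] are adjacent and begin at 1, so the partial sums, together
    with the central term on [0, 1], merge into one integral starting at 0. *)
Lemma is_lim_seq_image_coef (a : R) (n : nat) :
  0 < a ->
  is_lim_seq (fun N => RInt (fun y => exp (- (a * y ^ 2)) * cos (INR n * PI * y)) 0 (2 * INR (S N) + 1))
    (RInt (fun y => image_sum a y * cos (INR n * PI * y)) 0 1).
Proof.
  intros Ha. set (f := fun y => exp (- (a * y ^ 2)) * cos (INR n * PI * y)).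
  assert (Hex : forall u v, is_RInt f u v (RInt f u v)).
  { intros u v. apply (RInt_correct (V := R_CompleteNormedModule)), ex_RInt_continuous_global.
    apply gauss_cos_continuous. }
  set (w := INR n * PI).
  pose proof (is_series_cos_coef (image_term a) w (image_term_continuous a)
                (image_term_dominated a Ha)) as HS.
  assert (Hsum : forall N, RInt f 0 1 + sum_n (fun k => RInt (fun y => image_term a k y * cos (w * y)) 0 1) N
            = RInt f 0 (2 * INR (S N) + 1)).
  { assert (Hst : forall k, RInt f 0 (2 * INR (S k) - 1) + RInt (fun y => image_term a k y * cos (w * y)) 0 1
              = RInt f 0 (2 * INR (S k) + 1)).
    { intros k. unfold w. rewrite RInt_image_cos. symmetry. apply is_RInt_unique.
      exact (is_RInt_Chasles _ _ _ _ _ _ (Hex _ _) (Hex _ _)). }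
    induction N as [|N IH].
    - rewrite sum_O, <- Hst. simpl INR. f_equal. f_equal. ring.
    - rewrite sum_Sn, <- Hst.
      cbv beta; match goal with |- _ + plus ?u ?v = _ => change (RInt f 0 1 + (u + v) = RInt f 0 (2 * INR (S (S N)) - 1) + v) end.
      rewrite <- Rplus_assoc, IH. f_equal. f_equal. rewrite (S_INR (S N)). ring. }
  apply is_lim_seq_ext with (1 := Hsum).
  replace (RInt (fun y => image_sum a y * cos (w * y)) 0 1)
    with (RInt f 0 1 + RInt (fun y => Series (fun k => image_term a k y) * cos (w * y)) 0 1).
  - apply is_lim_seq_plus'; [apply is_lim_seq_const | exact HS].
  - symmetry. apply is_RInt_unique.
    assert (H2 : is_RInt (fun y => Series (fun k => image_term a k y) * cos (w * y)) 0 1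
                 (RInt (fun y => Series (fun k => image_term a k y) * cos (w * y)) 0 1)).
    { apply (RInt_correct (V := R_CompleteNormedModule)), ex_RInt_continuous_global. intros y.
      apply (continuous_mult (K := R_AbsRing)); [|apply continuous_cos_lin].
      apply Series_continuous; [apply image_term_continuous | apply image_term_dominated, Ha]. }
    eapply is_RInt_eq; [exact (is_RInt_plus _ _ _ _ _ _ (Hex 0 1) H2) | | reflexivity].
    intros y. unfold image_sum, f.
    cbv beta; match goal with |- plus ?u ?v = ?r => change (u + v = r) end. unfold w. ring.
Qed.

(** Integrating [exp (- a z ^ 2)] over the rectangle with vertices [0], [L], [L + i s], [i s]
    leaves only the edge at [L]; here the real part, differentiated in [s]. *)
Lemma is_derive_gauss_shift (a L s : R) :
  is_derive (fun s => RInt (fun y => exp (a * (s ^ 2 - y ^ 2)) * cos (2 * a * s * y)) 0 L) s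
    (exp (a * (s ^ 2 - L ^ 2)) * sin (2 * a * s * L)).
Proof.
  set (g := fun s y => exp (a * (s ^ 2 - y ^ 2)) * cos (2 * a * s * y)).
  set (dg := fun s y => exp (a * (s ^ 2 - y ^ 2)) * (2 * a * s * cos (2 * a * s * y)
                          - 2 * a * y * sin (2 * a * s * y))).
  assert (Hd : forall s y, is_derive (fun s => g s y) s (dg s y)).
  { intros s' y. unfold g, dg. auto_derive; [exact I|].
    replace (s' * (s' * 1) + - (y * (y * 1))) with (s' ^ 2 - y ^ 2) by ring. ring. }
  assert (HD : forall s y, Derive (fun s => g s y) s = dg s y).
  { intros; apply is_derive_unique, Hd. }
  replace (exp (a * (s ^ 2 - L ^ 2)) * sin (2 * a * s * L))
    with (RInt (fun y => Derive (fun s => g s y) s) 0 L).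
  - apply (is_derive_RInt_param g 0 L s).
    + apply filter_forall. intros x t _. exists (dg x t). apply Hd.
    + intros t _. apply continuity_2d_pt_ext with dg; [intros; symmetry; apply HD|].
      unfold dg.
      assert (C1 : continuity_2d_pt (fun s _ => s) s t) by apply continuity_2d_pt_id1.
      assert (C2 : continuity_2d_pt (fun _ y => y) s t) by apply continuity_2d_pt_id2.
      assert (Ca : forall k, continuity_2d_pt (fun _ _ => k) s t) by (intros; apply continuity_2d_pt_const).
      assert (C3 : continuity_2d_pt (fun s y => 2 * a * s * y) s t).
      { repeat apply continuity_2d_pt_mult; auto. }
      apply continuity_2d_pt_mult.
      * apply (continuity_1d_2d_pt_comp exp (fun s y => a * (s ^ 2 - y ^ 2))).
        { apply derivable_continuous_pt, derivable_pt_exp. }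
        apply continuity_2d_pt_mult; [apply Ca|].
        apply continuity_2d_pt_minus;
          (apply continuity_2d_pt_mult; [|apply continuity_2d_pt_mult]); auto.
      * apply continuity_2d_pt_minus; apply continuity_2d_pt_mult.
        { repeat apply continuity_2d_pt_mult; auto. }
        { apply (continuity_1d_2d_pt_comp cos (fun s y => 2 * a * s * y)); [apply continuity_cos | exact C3]. }
        { repeat apply continuity_2d_pt_mult; auto. }
        { apply (continuity_1d_2d_pt_comp sin (fun s y => 2 * a * s * y)); [apply continuity_sin | exact C3]. }
    + apply filter_forall. intros x. apply ex_RInt_continuous_global. intros y.
      apply (ex_derive_continuous (V := R_NormedModule)). unfold g. auto_derive. exact I.
  (* Cauchy-Riemann: the [s]-derivative of the real part is the [y]-derivative of [exp (a * (s ^ 2 -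
     y ^ 2)) * sin (2 * a * s * y)], which vanishes at [y = 0]. *)
  - rewrite (RInt_ext _ (dg s)) by (intros; apply HD).
    apply is_RInt_unique.
    eapply is_RInt_eq;
      [apply (is_RInt_derive (V := R_CompleteNormedModule)
                (fun y => exp (a * (s ^ 2 - y ^ 2)) * sin (2 * a * s * y)) (dg s) 0 L) | reflexivity |].
    + intros y _. unfold dg. auto_derive; [exact I|].
      replace (s * (s * 1) + - (y * (y * 1))) with (s ^ 2 - y ^ 2) by ring. ring.
    + intros y _. apply (ex_derive_continuous (V := R_NormedModule)). unfold dg. auto_derive. exact I.
    + cbv beta; match goal with |- minus ?u ?v = ?r => change (u - v = r) end.
      rewrite Rmult_0_r, sin_0. ring.
Qed.

(** The mean value theorem in the shift parameter, from 0 to [s]: the derivative is the contribution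
    of the edge at [L], which is negligible for large [L]. *)
Lemma gauss_shift_bound (a L s : R) :
  0 < a -> 0 <= s ->
  Rabs (exp (a * s ^ 2) * RInt (fun y => exp (- (a * y ^ 2)) * cos (2 * a * s * y)) 0 L
        - RInt (fun y => exp (- (a * y ^ 2))) 0 L) <= s * exp (a * s ^ 2) * exp (- (a * L ^ 2)).
Proof.
  intros Ha Hs.
  set (P := fun s => RInt (fun y => exp (a * (s ^ 2 - y ^ 2)) * cos (2 * a * s * y)) 0 L).
  destruct (MVT_gen P 0 s (fun s => exp (a * (s ^ 2 - L ^ 2)) * sin (2 * a * s * L))) as [x [Hx HM]].
  { intros x _. apply is_derive_gauss_shift. }
  { intros x _. apply continuity_pt_filterlim. eapply is_derive_continuous, is_derive_gauss_shift. }
  rewrite Rmin_left, Rmax_right in Hx by lra.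
  replace (exp (a * s ^ 2) * RInt (fun y => exp (- (a * y ^ 2)) * cos (2 * a * s * y)) 0 L) with (P s).
  2:{ apply is_RInt_unique. eapply is_RInt_eq.
      - exact (is_RInt_scal _ _ _ (exp (a * s ^ 2)) _ (RInt_correct (V := R_CompleteNormedModule) _ _ _
           (ex_RInt_continuous_global _ 0 L (gauss_cos_continuous a (2 * a * s))))).
      - intros y. change (scal (V := R_NormedModule)) with Rmult. cbv beta.
        rewrite <- Rmult_assoc, <- exp_plus. f_equal. f_equal. ring.
      - reflexivity. }
  replace (RInt (fun y => exp (- (a * y ^ 2))) 0 L) with (P 0).
  2:{ apply RInt_ext. intros y _. rewrite Rmult_0_r, Rmult_0_l, cos_0, Rmult_1_r. f_equal. ring. }
  rewrite HM. rewrite !Rabs_mult, (Rabs_pos_eq (exp _)), (Rabs_pos_eq (s - 0)) by (try (left; apply exp_pos); lra).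
  replace (s * exp (a * s ^ 2) * exp (- (a * L ^ 2))) with (exp (a * (s ^ 2 - L ^ 2)) * 1 * (s - 0)).
  2:{ rewrite Rmult_1_r, Rminus_0_r, Rmult_assoc, <- exp_plus, Rmult_comm. f_equal. f_equal. ring. }
  apply Rmult_le_compat_r; [lra|].
  apply Rmult_le_compat; [left; apply exp_pos | apply Rabs_pos | | apply Rabs_le, SIN_bound].
  apply exp_nondecreasing. apply Rmult_le_compat_l; [lra|].
  assert (x ^ 2 <= s ^ 2) by (apply pow_incr; lra). lra.
Qed.

Lemma RInt_image_sum_cos (a : R) (n : nat) :
  0 < a ->
  RInt (fun y => image_sum a y * cos (INR n * PI * y)) 0 1
    = exp (- (INR n ^ 2 * PI ^ 2 * / (4 * a))) * RInt (image_sum a) 0 1.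
Proof.
  intros Ha. pose proof PI_RGT_0.
  (* The shift for which the frequency [2 * a * s] is [INR n * PI]; then [a * s ^ 2] is the exponent
     in the conclusion. *)
  set (s := INR n * PI / (2 * a)).
  assert (Hs : 0 <= s) by (apply Rdiv_le_0_compat; [apply Rmult_le_pos; [apply pos_INR | lra] | lra]).
  pose proof (is_lim_seq_image_coef a n Ha) as Hn.
  pose proof (is_lim_seq_image_coef a 0 Ha) as H0.
  rewrite (RInt_ext (fun y => image_sum a y * cos (INR 0 * PI * y)) (image_sum a)) in H0.
  2:{ intros y _. change (INR 0) with 0. rewrite !Rmult_0_l, cos_0. apply Rmult_1_r. }
  set (E := exp (a * s ^ 2)).
  pose proof (is_lim_seq_minus' _ _ _ _ (is_lim_seq_mult' _ _ _ _ (is_lim_seq_const E) Hn) H0) as HL.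
  assert (Hz : is_lim_seq (fun N =>
     E * RInt (fun y => exp (- (a * y ^ 2)) * cos (INR n * PI * y)) 0 (2 * INR (S N) + 1)
     - RInt (fun y => exp (- (a * y ^ 2)) * cos (INR 0 * PI * y)) 0 (2 * INR (S N) + 1)) 0).
  { apply is_lim_seq_abs_0.
    apply is_lim_seq_le_le with (fun _ => 0) (fun N => s * E * exp (- a) ^ N).
    - intros N. split; [apply Rabs_pos|].
      set (L := 2 * INR (S N) + 1).
      rewrite (RInt_ext (fun y => exp (- (a * y ^ 2)) * cos (INR 0 * PI * y)) (fun y => exp (- (a * y ^ 2)))).
      2:{ intros y _. change (INR 0) with 0. rewrite !Rmult_0_l, cos_0. apply Rmult_1_r. }
      rewrite (RInt_ext (fun y => exp (- (a * y ^ 2)) * cos (INR n * PI * y))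
                (fun y => exp (- (a * y ^ 2)) * cos (2 * a * s * y))).
      2:{ intros y _. f_equal. f_equal. unfold s. field. lra. }
      eapply Rle_trans; [apply gauss_shift_bound; lra|].
      fold E. apply Rmult_le_compat_l; [apply Rmult_le_pos; [lra | left; apply exp_pos]|].
      rewrite exp_pow_INR.
      apply exp_nondecreasing.
      assert (INR N * 1 <= L ^ 2).
      { unfold L. rewrite S_INR. pose proof (pos_INR N). nra. }
      assert (a * (INR N * 1) <= a * L ^ 2) by (apply Rmult_le_compat_l; lra). lra.
    - apply is_lim_seq_const.
    - replace 0 with (s * E * 0) by ring.
      apply is_lim_seq_mult'; [apply is_lim_seq_const|]. apply is_lim_seq_geom.
      rewrite Rabs_pos_eq by (left; apply exp_pos). rewrite <- exp_0. apply exp_increasing. lra. }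
  (* The same sequence converges to [E] times the coefficient of index [n] minus that of index 0,
     and to 0; equating the limits gives the claim. *)
  apply is_lim_seq_unique in HL. apply is_lim_seq_unique in Hz. rewrite HL in Hz.
  injection Hz as Hz.
  assert (HE : E * exp (- (INR n ^ 2 * PI ^ 2 * / (4 * a))) = 1).
  { unfold E. rewrite <- exp_plus.
    replace (a * s ^ 2 + - (INR n ^ 2 * PI ^ 2 * / (4 * a))) with 0 by (unfold s; field; lra).
    apply exp_0. }
  apply Rmult_eq_reg_l with E; [|unfold E; apply Rgt_not_eq, exp_pos].
  rewrite <- Rmult_assoc, HE, Rmult_1_l. lra.
Qed.

(** The cosine coefficients of the two sides agree for every [n], once the coefficient of index 0,
    here [J], is kept as an unevaluated factor; completeness of the cosines then applies to the
    difference. *)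
Lemma image_sum_theta (a y : R) :
  0 < a -> 0 <= y <= 1 -> image_sum a y = RInt (image_sum a) 0 1 * theta (/ (4 * a)) y.
Proof.
  intros Ha Hy. set (J := RInt (image_sum a) 0 1).
  assert (Hc : 0 < / (4 * a)) by (apply Rinv_0_lt_compat; lra).
  assert (H : 1 * image_sum a y + - J * theta (/ (4 * a)) y = 0); [|lra].
  apply (cos_orthogonal_eq_0 (fun y => 1 * image_sum a y + - J * theta (/ (4 * a)) y)); [|exact Hy].
  split.
  - intros z. apply (continuous_plus (V := R_NormedModule)).
    + apply (continuous_scal_r (V := R_NormedModule) 1), image_sum_continuous, Ha.
    + apply (continuous_scal_r (V := R_NormedModule) (- J)), theta_continuous, Hc.
  - intros n.
    assert (H1 : is_RInt (fun y => image_sum a y * cos (INR n * PI * y)) 0 1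
              (exp (- (INR n ^ 2 * PI ^ 2 * / (4 * a))) * J)).
    { unfold J. rewrite <- RInt_image_sum_cos by exact Ha.
      apply (RInt_correct (V := R_CompleteNormedModule)), ex_RInt_continuous_global. intros z.
      apply (continuous_mult (K := R_AbsRing)); [apply image_sum_continuous, Ha | apply continuous_cos_lin]. }
    pose proof (is_RInt_theta_cos _ n Hc) as H2.
    eapply is_RInt_eq; [exact (is_RInt_plus _ _ _ _ _ _ H1 (is_RInt_scal _ _ _ (- J) _ H2)) | |].
    + intros z. change (scal (V := R_NormedModule)) with Rmult.
      cbv beta; match goal with |- plus ?u ?v = ?r => change (u + v = r) end. ring.
    + change (scal (V := R_NormedModule)) with Rmult.
      cbv beta; match goal with |- plus ?u ?v = ?r => change (u + v = r) end. ring.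
Qed.

(** * The normalising constant *)

(** The substitution by [sqrt a] turns every parameter into the same Gaussian; only the sequence of
    upper limits still depends on [a]. *)
Lemma is_lim_seq_gauss (a : R) :
  0 < a ->
  is_lim_seq (fun N => RInt (fun y => exp (- (1 * y ^ 2))) 0 (sqrt a * (2 * INR (S N) + 1)))
    (sqrt a * RInt (image_sum a) 0 1).
Proof.
  intros Ha. pose proof (sqrt_lt_R0 a Ha) as Hs.
  pose proof (is_lim_seq_image_coef a 0 Ha) as H0.
  rewrite (RInt_ext (fun y => image_sum a y * cos (INR 0 * PI * y)) (image_sum a)) in H0.
  2:{ intros y _. change (INR 0) with 0. rewrite !Rmult_0_l, cos_0. apply Rmult_1_r. }
  pose proof (is_lim_seq_mult' _ _ _ _ (is_lim_seq_const (sqrt a)) H0) as H1.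
  eapply is_lim_seq_ext; [|exact H1]. intros N. cbv beta.
  set (L := 2 * INR (S N) + 1).
  pose proof (RInt_correct (V := R_CompleteNormedModule) _ _ _
    (ex_RInt_continuous_global _ (sqrt a * 0 + 0) (sqrt a * L + 0) (gauss_continuous 1))) as HI.
  apply (is_RInt_comp_lin (V := R_NormedModule)) in HI.
  rewrite Rmult_0_r, !Rplus_0_r in HI.
  apply (is_RInt_unique (V := R_CompleteNormedModule)) in HI. eapply eq_trans; [|exact HI].
  symmetry. apply is_RInt_unique.
  eapply is_RInt_eq.
  - exact (is_RInt_scal _ _ _ (sqrt a) _ (RInt_correct (V := R_CompleteNormedModule) _ _ _
           (ex_RInt_continuous_global _ 0 L (gauss_cos_continuous a (INR 0 * PI))))).
  - intros y.
    change (sqrt a * (exp (- (a * y ^ 2)) * cos (0 * PI * y)) = sqrt a * exp (- (1 * (sqrt a * y + 0) ^ 2))).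
    rewrite !Rmult_0_l, cos_0, Rmult_1_r, Rplus_0_r. f_equal. f_equal.
    rewrite Rpow_mult_distr, pow2_sqrt by lra. ring.
  - reflexivity.
Qed.

(** The truncated integrals increase with the upper limit, so the limit along one unbounded sequence
    bounds them all, hence also the limit along any other. Exchanging [a] and [b] shows that
    [sqrt a * RInt (image_sum a) 0 1] does not depend on [a]. *)
Lemma gauss_limits_le (a b : R) :
  0 < a -> 0 < b ->
  sqrt a * RInt (image_sum a) 0 1 <= sqrt b * RInt (image_sum b) 0 1.
Proof.
  intros Ha Hb. pose proof (sqrt_lt_R0 b Hb) as Hs.
  set (I := fun L => RInt (fun y => exp (- (1 * y ^ 2))) 0 L).
  assert (HI : forall u v, u <= v -> I u <= I v).
  { intros u v Huv. unfold I.
    assert (Hex : forall x z, is_RInt (fun y => exp (- (1 * y ^ 2))) x z (RInt (fun y => exp (- (1 * y ^ 2))) x z)).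
    { intros x z. apply (RInt_correct (V := R_CompleteNormedModule)), ex_RInt_continuous_global, gauss_continuous. }
    assert (HC : RInt (fun y => exp (- (1 * y ^ 2))) 0 v
              = RInt (fun y => exp (- (1 * y ^ 2))) 0 u + RInt (fun y => exp (- (1 * y ^ 2))) u v).
    { apply is_RInt_unique. exact (is_RInt_Chasles _ _ _ _ _ _ (Hex 0 u) (Hex u v)). }
    assert (0 <= RInt (fun y => exp (- (1 * y ^ 2))) u v).
    { apply RInt_ge_0; [exact Huv | eexists; apply Hex | intros; left; apply exp_pos]. }
    lra. }
  pose proof (is_lim_seq_gauss b Hb) as HB.
  assert (Hup : forall L, I L <= sqrt b * RInt (image_sum b) 0 1).
  { intros L. destruct (INR_unbounded (L / sqrt b)) as [m Hm].
    apply (is_lim_seq_le_loc (fun _ => I L) (fun N => I (sqrt b * (2 * INR (S N) + 1))) (I L) (sqrt b * RInt (image_sum b) 0 1));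
      [|apply is_lim_seq_const | exact HB].
    exists m. intros N HN. apply HI.
    assert (INR m <= INR N) by (apply le_INR; exact HN). rewrite S_INR.
    assert (L = sqrt b * (L / sqrt b)) by (field; lra).
    rewrite H0. apply Rmult_le_compat_l; [lra|]. pose proof (pos_INR N). lra. }
  apply (is_lim_seq_le _ _ (sqrt a * RInt (image_sum a) 0 1) (sqrt b * RInt (image_sum b) 0 1)
           (fun N => Hup _) (is_lim_seq_gauss a Ha) (is_lim_seq_const _)).
Qed.

(** The value [a = PI / 4] is fixed by the duality [4 a <-> PI ^ 2 / (4 a)], so that
    [image_sum_theta] at [y = 0] determines its own constant, i.e. the Gaussian integral. *)
Lemma RInt_image_sum_self_dual : RInt (image_sum (PI / 4)) 0 1 = 1.
Proof.
  pose proof PI_RGT_0.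
  assert (Ha : 0 < PI / 4) by lra.
  pose proof (image_sum_theta (PI / 4) 0 Ha ltac:(lra)) as HT.
  assert (Hc : 0 < / (4 * (PI / 4))) by (apply Rinv_0_lt_compat; lra).
  assert (E : image_sum (PI / 4) 0 = theta (/ (4 * (PI / 4))) 0).
  { unfold image_sum, theta. f_equal.
    - replace (- (PI / 4 * 0 ^ 2)) with 0 by ring. apply exp_0.
    - rewrite <- Series_scal_l. apply Series_ext. intros n. unfold image_term, theta_term.
      rewrite Rmult_0_r, cos_0, Rmult_1_l.
      replace (- (PI / 4 * (0 - 2 * INR (S n)) ^ 2)) with (- (INR (S n) ^ 2 * PI)) by field.
      replace (- (PI / 4 * (0 + 2 * INR (S n)) ^ 2)) with (- (INR (S n) ^ 2 * PI)) by field.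
      replace (- (INR (S n) ^ 2 * PI ^ 2 * / (4 * (PI / 4)))) with (- (INR (S n) ^ 2 * PI)) by (field; lra).
      ring. }
  (* The self-dual identity reads [theta = J * theta]; this bound permits the cancellation. *)
  assert (Hp : 1 <= theta (/ (4 * (PI / 4))) 0).
  { unfold theta.
    assert (0 <= Series (fun n => theta_term (/ (4 * (PI / 4))) n 0)); [|lra].
    apply Series_nonneg; [apply (locally_dominated_ex_series (theta_term (/ (4 * (PI / 4))))), theta_term_dominated, Hc|].
    intros n. unfold theta_term. rewrite Rmult_0_r, cos_0, Rmult_1_l. left; apply exp_pos. }
  rewrite E in HT. apply Rmult_eq_reg_r with (theta (/ (4 * (PI / 4))) 0); lra.
Qed.

Lemma RInt_image_sum (a : R) : 0 < a -> RInt (image_sum a) 0 1 = sqrt PI / (2 * sqrt a).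
Proof.
  intros Ha. pose proof PI_RGT_0. pose proof (sqrt_lt_R0 a Ha).
  assert (Hq : 0 < PI / 4) by lra.
  assert (E : sqrt a * RInt (image_sum a) 0 1 = sqrt (PI / 4) * RInt (image_sum (PI / 4)) 0 1).
  { apply Rle_antisym; apply gauss_limits_le; assumption. }
  rewrite RInt_image_sum_self_dual, Rmult_1_r, sqrt_div_alt in E by lra.
  replace 4 with (2 * 2) in E by ring. rewrite sqrt_square in E by lra.
  apply Rmult_eq_reg_l with (sqrt a); [|lra]. rewrite E. field. lra.
Qed.

Lemma theta_images (c y : R) :
  0 < c -> 0 <= y <= 1 -> sqrt c * theta c y = / sqrt PI * image_sum (/ (4 * c)) y.
Proof.
  intros Hc Hy. pose proof PI_RGT_0. pose proof (sqrt_lt_R0 c Hc). pose proof (sqrt_lt_R0 PI PI_RGT_0).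
  assert (Ha : 0 < / (4 * c)) by (apply Rinv_0_lt_compat; lra).
  rewrite (image_sum_theta _ y Ha Hy), RInt_image_sum by exact Ha.
  replace (/ (4 * / (4 * c))) with c by (field; lra).
  rewrite sqrt_inv, sqrt_mult by lra.
  replace (sqrt 4) with 2.
  2:{ replace 4 with (2 * 2) by ring. symmetry. apply sqrt_square. lra. }
  field. split; lra.
Qed.

(** * Derivatives on an interval and scaled smooth families *)

(** Properness makes the limit of the difference quotients unique, so that the [iota] in [Derive_on]
    returns it, including at the end points. *)
Lemma within_interval_proper (lo hi x : R) :
  lo < hi -> lo <= x <= hi -> ProperFilter' (within (fun y => lo <= y <= hi) (locally' x)).
Proof.
  intros Hlt Hx. constructor.
  - intros [d Hd]. pose proof (cond_pos d).
    set (s := Rmin (d / 2) ((hi - lo) / 2)).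
    assert (Hs : 0 < s) by (unfold s; apply Rmin_pos; lra).
    assert (Hs1 : s <= d / 2) by apply Rmin_l. assert (Hs2 : s <= (hi - lo) / 2) by apply Rmin_r.
    destruct (Rle_dec x ((lo + hi) / 2)).
    + apply (Hd (x + s)); [|lra|lra]. change (Rabs (x + s - x) < d). apply Rabs_def1; lra.
    + apply (Hd (x - s)); [|lra|lra]. change (Rabs (x - s - x) < d). apply Rabs_def1; lra.
  - apply within_filter. apply locally'_filter.
Qed.

Lemma is_derive_on_of_is_derive (lo hi : R) (f g : R -> R) (x l : R) :
  lo <= x <= hi -> (forall y, lo <= y <= hi -> g y = f y) -> is_derive f x l ->
  is_derive_on lo hi g x l.
Proof.
  intros Hx E Hd. apply is_derive_Reals in Hd. apply filterlim_locally. intros eps.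
  destruct (Hd eps (cond_pos eps)) as [d Hdd]. exists d. intros y Hy Hne Hin.
  change (Rabs (y - x) < d) in Hy.
  change (Rabs ((g y - g x) / (y - x) - l) < eps).
  rewrite (E y Hin), (E x Hx).
  replace (f y) with (f (x + (y - x))) by (f_equal; ring).
  apply Hdd; [lra | exact Hy].
Qed.

Lemma Derive_on_of_is_derive (lo hi : R) (f g : R -> R) (x l : R) :
  lo < hi -> lo <= x <= hi -> (forall y, lo <= y <= hi -> g y = f y) -> is_derive f x l ->
  Derive_on lo hi g x = l.
Proof.
  intros Hlt Hx E Hd. unfold Derive_on, is_derive_on.
  apply (iota_filterlim_locally (V := R_CompleteNormedModule)
           (FF := within_interval_proper lo hi x Hlt Hx)).
  apply (is_derive_on_of_is_derive lo hi f g x l); assumption.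
Qed.

Lemma Derive_n_on_eq (lo hi : R) (g : R -> R) (D : nat -> R -> R) (n : nat) :
  lo < hi -> (forall y, lo <= y <= hi -> g y = D 0%nat y) ->
  (forall j y, (j < n)%nat -> lo <= y <= hi -> is_derive (D j) y (D (S j) y)) ->
  forall j y, (j <= n)%nat -> lo <= y <= hi -> Derive_n_on lo hi g j y = D j y.
Proof.
  intros Hlt H0 HD. induction j as [|j IH]; intros y Hj Hy; [apply H0, Hy|].
  apply (Derive_on_of_is_derive lo hi (D j)); auto.
  - intros z Hz. apply IH; [lia | exact Hz].
Qed.

Lemma is_Ck_of_derivatives (lo hi : R) (g : R -> R) (D : nat -> R -> R) (n : nat) :
  lo < hi -> (forall y, lo <= y <= hi -> g y = D 0%nat y) ->
  (forall j y, (j < S n)%nat -> lo <= y <= hi -> is_derive (D j) y (D (S j) y)) ->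
  is_Ck n lo hi g.
Proof.
  intros Hlt H0 HD.
  assert (E : forall j y, (j <= n)%nat -> lo <= y <= hi -> Derive_n_on lo hi g j y = D j y).
  { intros j y Hj Hy. apply (Derive_n_on_eq lo hi g D (S n)); auto. }
  split; intros j x Hj Hx.
  - exists (D (S j) x). apply (is_derive_on_of_is_derive lo hi (D j)); auto.
    intros y Hy. apply E; [lia | exact Hy].
  - unfold continuous_within. rewrite (E j x Hj Hx).
    assert (HC : continuous (D j) x) by (eapply is_derive_continuous, HD; [lia | exact Hx]).
    apply filterlim_locally. intros eps.
    destruct (proj1 (filterlim_locally _ _) HC eps) as [d Hd].
    exists d. intros y Hy Hin. rewrite (E j y Hj Hin). apply Hd, Hy.
Qed.

(** Families [F c xi] whose [j]-th derivatives in [xi], [j <= n], are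
    [O(A c * c ^ (- j / 2))], uniformly in [0 < c <= c1] and [0 <= xi <= rad]. *)
Fixpoint scaled_Cn (rad c1 : R) (n : nat) (A : R -> R) (F : R -> R -> R) : Prop :=
  (exists K, 0 <= K /\
    forall c xi, 0 < c <= c1 -> 0 <= xi <= rad -> Rabs (F c xi) <= K * A c) /\
  match n with
  | O => True
  | S m => exists F' : R -> R -> R,
      (forall c xi, 0 < c <= c1 -> 0 <= xi <= rad -> is_derive (F c) xi (F' c xi)) /\
      scaled_Cn rad c1 m (fun c => A c / sqrt c) F'
  end.

Lemma scaled_Cn_bound (rad c1 : R) (n : nat) (A : R -> R) (F : R -> R -> R) :
  scaled_Cn rad c1 n A F -> exists K, 0 <= K /\
    forall c xi, 0 < c <= c1 -> 0 <= xi <= rad -> Rabs (F c xi) <= K * A c.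
Proof. destruct n; intros H; apply (proj1 H). Qed.

Lemma scaled_Cn_weight (rad c1 : R) (n : nat) (A B : R -> R) (F : R -> R -> R) :
  (forall c, 0 < c <= c1 -> A c <= B c) -> scaled_Cn rad c1 n A F -> scaled_Cn rad c1 n B F.
Proof.
  revert A B F. induction n as [|n IH]; intros A B F Hle [[K [HK Hb]] H];
    (split; [exists K; split; [exact HK|]; intros c xi Hc Hxi; eapply Rle_trans;
       [apply Hb; assumption | apply Rmult_le_compat_l; [exact HK | apply Hle, Hc]]|]).
  - exact I.
  - destruct H as [F' [HF H]]. exists F'. split; [exact HF|].
    apply IH with (fun c => A c / sqrt c); [|exact H].
    intros c Hc. apply Rmult_le_compat_r; [|apply Hle, Hc].
    left. apply Rinv_0_lt_compat, sqrt_lt_R0. lra.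
Qed.

Lemma scaled_Cn_pred (rad c1 : R) (n : nat) (A : R -> R) (F : R -> R -> R) :
  scaled_Cn rad c1 (S n) A F -> scaled_Cn rad c1 n A F.
Proof.
  revert A F. induction n as [|n IH]; intros A F [Hb [F' [HF H]]]; split; auto.
  exists F'. split; [exact HF | apply IH, H].
Qed.

Lemma scaled_Cn_plus (rad c1 : R) (n : nat) (A : R -> R) (F G : R -> R -> R) :
  scaled_Cn rad c1 n A F -> scaled_Cn rad c1 n A G ->
  scaled_Cn rad c1 n A (fun c xi => F c xi + G c xi).
Proof.
  revert A F G. induction n as [|n IH]; intros A F G [[K [HK Hb]] H] [[L [HL Hg]] H'];
    (split; [exists (K + L); split; [lra|]; intros c xi Hc Hxi;
       specialize (Hb c xi Hc Hxi); specialize (Hg c xi Hc Hxi);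
       eapply Rle_trans; [apply Rabs_triang | lra]|]).
  - exact I.
  - destruct H as [F' [HF H]]. destruct H' as [G' [HG H']].
    exists (fun c xi => F' c xi + G' c xi). split; [|apply IH; assumption].
    intros c xi Hc Hxi. apply (is_derive_plus (V := R_NormedModule)); auto.
Qed.

(** Leibniz' rule by induction on the order: each summand of the derivative differentiates one
    factor and so pays one [1 / sqrt c], while the other factor is used at the lower order through
    [scaled_Cn_pred]. *)
Lemma scaled_Cn_mult (rad c1 : R) (n : nat) (A B : R -> R) (F G : R -> R -> R) :
  scaled_Cn rad c1 n A F -> scaled_Cn rad c1 n B G ->
  scaled_Cn rad c1 n (fun c => A c * B c) (fun c xi => F c xi * G c xi).
Proof.
  revert A B F G. induction n as [|n IH]; intros A B F G HFn HGn;
    pose proof HFn as [[K [HK Hb]] H]; pose proof HGn as [[L [HL Hg]] H'];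
    (split; [exists (K * L); split; [apply Rmult_le_pos; assumption|]; intros c xi Hc Hxi;
       rewrite Rabs_mult; replace (K * L * (A c * B c)) with ((K * A c) * (L * B c)) by ring;
       apply Rmult_le_compat; auto using Rabs_pos|]).
  - exact I.
  - destruct H as [F' [HF H]]. destruct H' as [G' [HG H']].
    exists (fun c xi => F' c xi * G c xi + F c xi * G' c xi). split.
    + intros c xi Hc Hxi.
      apply (is_derive_mult (F c) (G c) xi (F' c xi) (G' c xi)); auto.
      intros; apply Rmult_comm.
    + apply scaled_Cn_plus.
      * apply scaled_Cn_weight with (fun c => A c / sqrt c * B c).
        { intros c _. right. unfold Rdiv. ring. }
        apply IH; [exact H | apply scaled_Cn_pred, HGn].
      * apply scaled_Cn_weight with (fun c => A c * (B c / sqrt c)).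
        { intros c _. right. unfold Rdiv. ring. }
        apply IH; [apply scaled_Cn_pred, HFn | exact H'].
Qed.

(** For [c <= 1] the price of a derivative is at least 1, so families independent of [c] with
    bounded derivatives also belong to the scaled class. *)
Lemma inv_sqrt_ge_1 (c : R) : 0 < c <= 1 -> 1 <= / sqrt c.
Proof.
  intros Hc. rewrite <- Rinv_1. apply Rinv_le_contravar; [apply sqrt_lt_R0; lra|].
  rewrite <- sqrt_1. apply sqrt_le_1; lra.
Qed.

Lemma scaled_Cn_const (rad c1 k : R) (n : nat) (A : R -> R) :
  c1 <= 1 -> (forall c, 0 < c <= c1 -> 1 <= A c) -> scaled_Cn rad c1 n A (fun _ _ => k).
Proof.
  intros Hc1. revert k A. induction n as [|n IH]; intros k A HA;
    (split; [exists (Rabs k); split; [apply Rabs_pos|]; intros c xi Hc _;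
       rewrite <- (Rmult_1_r (Rabs k)) at 1;
       apply Rmult_le_compat_l; [apply Rabs_pos | apply HA, Hc]|]).
  - exact I.
  - exists (fun _ _ => 0). split.
    + intros c xi _ _. apply (is_derive_const (V := R_NormedModule)).
    + apply IH. intros c Hc. rewrite <- (Rmult_1_l 1).
      apply Rmult_le_compat; try lra; [apply HA, Hc | apply inv_sqrt_ge_1; lra].
Qed.

Lemma scaled_Cn_scal (rad c1 k : R) (n : nat) (A : R -> R) (F : R -> R -> R) :
  c1 <= 1 -> scaled_Cn rad c1 n A F -> scaled_Cn rad c1 n A (fun c xi => k * F c xi).
Proof.
  intros Hc1 H. apply scaled_Cn_weight with (fun c => 1 * A c); [intros; lra|].
  apply (scaled_Cn_mult rad c1 n (fun _ => 1) A (fun _ _ => k)); [|exact H].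
  apply scaled_Cn_const; [exact Hc1 | intros; lra].
Qed.

(** The derivative of [/ F] is [- F' * (/ F) ^ 2], in which the inverse occurs undifferentiated: the
    induction hypothesis and the product rule finish. *)
Lemma scaled_Cn_inv (rad c1 d : R) (n : nat) (F : R -> R -> R) :
  c1 <= 1 -> 0 < d -> (forall c xi, 0 < c <= c1 -> 0 <= xi <= rad -> d <= F c xi) ->
  scaled_Cn rad c1 n (fun _ => 1) F -> scaled_Cn rad c1 n (fun _ => 1) (fun c xi => / F c xi).
Proof.
  intros Hc1 Hd HF.
  assert (Hb : exists K, 0 <= K /\
    forall c xi, 0 < c <= c1 -> 0 <= xi <= rad -> Rabs (/ F c xi) <= K * 1).
  { exists (/ d). split; [left; apply Rinv_0_lt_compat, Hd|]. intros c xi Hc Hxi.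
    specialize (HF c xi Hc Hxi).
    rewrite Rmult_1_r, Rabs_pos_eq by (left; apply Rinv_0_lt_compat; lra).
    apply Rinv_le_contravar; lra. }
  induction n as [|n IH]; intros H; (split; [exact Hb|]); [exact I|].
  pose proof (IH (scaled_Cn_pred _ _ _ _ _ H)) as HI.
  destruct H as [_ [F' [HD H]]].
  exists (fun c xi => -1 * (F' c xi * (/ F c xi * / F c xi))). split.
  - intros c xi Hc Hxi. specialize (HF c xi Hc Hxi).
    replace (-1 * (F' c xi * (/ F c xi * / F c xi))) with (- F' c xi / F c xi ^ 2) by (field; lra).
    apply is_derive_inv; [apply HD; assumption | lra].
  - apply scaled_Cn_scal; [exact Hc1|].
    apply scaled_Cn_weight with (fun c => 1 / sqrt c * (1 * 1)); [intros; lra|].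
    apply (scaled_Cn_mult rad c1 n (fun c => 1 / sqrt c) (fun _ => 1 * 1)); [exact H|].
    apply (scaled_Cn_mult rad c1 n (fun _ => 1) (fun _ => 1)); exact HI.
Qed.

(** [scaled_Cn] hides the successive derivatives in nested existentials; the norm needs them as one
    sequence. *)
Lemma scaled_Cn_derivatives (rad c1 : R) (n : nat) (A : R -> R) (F : R -> R -> R) :
  scaled_Cn rad c1 n A F ->
  exists D : nat -> R -> R -> R,
    (forall c xi, D 0%nat c xi = F c xi) /\
    (forall j c xi, (j < n)%nat -> 0 < c <= c1 -> 0 <= xi <= rad ->
       is_derive (D j c) xi (D (S j) c xi)) /\
    (forall j, (j <= n)%nat -> exists K, 0 <= K /\
       forall c xi, 0 < c <= c1 -> 0 <= xi <= rad -> Rabs (D j c xi) <= K * (A c / sqrt c ^ j)).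
Proof.
  revert A F. induction n as [|n IH]; intros A F H; pose proof (scaled_Cn_bound _ _ _ _ _ H) as [K [HK Hb]].
  - exists (fun _ => F). split; [reflexivity|]. split; [intros; lia|].
    intros j Hj. replace j with 0%nat by lia. exists K. split; [exact HK|]. intros c xi Hc Hxi.
    simpl. unfold Rdiv. rewrite Rinv_1, Rmult_1_r. auto.
  - destruct H as [_ [F' [HF H]]]. destruct (IH _ _ H) as [D [D0 [D1 D2]]].
    exists (fun j => match j with O => F | S i => D i end). split; [reflexivity|]. split.
    + intros [|j] c xi Hj Hc Hxi; [rewrite D0; auto | apply D1; auto; lia].
    + intros [|j] Hj.
      * exists K. split; [exact HK|]. intros c xi Hc Hxi.
        simpl. unfold Rdiv. rewrite Rinv_1, Rmult_1_r. auto.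
      * destruct (D2 j) as [L [HL HbD]]; [lia|]. exists L. split; [exact HL|]. intros c xi Hc Hxi.
        replace (A c / sqrt c ^ S j) with (A c / sqrt c / sqrt c ^ j); [auto|].
        assert (sqrt c > 0) by (apply sqrt_lt_R0; lra). simpl. field.
        split; [apply pow_nonzero|]; lra.
Qed.

(** The bounds for [j <= n] are absorbed into that for [j = n], as [c <= 1]. *)
Lemma scaled_Cn_Ck_norm (rad c1 : R) (n : nat) (A : R -> R) (F g : R -> R -> R) :
  0 < rad -> c1 <= 1 -> (forall c, 0 < c <= c1 -> 0 <= A c) -> scaled_Cn rad c1 n A F ->
  (forall c xi, 0 < c <= c1 -> 0 <= xi <= rad -> g c xi = F c xi) ->
  exists K, 0 < K /\ forall c, 0 < c <= c1 ->
    Rbar_le (Ck_norm n 0 rad (g c)) (K * (A c / sqrt c ^ n)).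
Proof.
  intros Hrad Hc1 HA H Hg. destruct (scaled_Cn_derivatives _ _ _ _ _ H) as [D [D0 [D1 D2]]].
  assert (HK : forall m, (m <= n)%nat -> exists K, 0 < K /\ forall j c xi, (j <= m)%nat ->
     0 < c <= c1 -> 0 <= xi <= rad -> Rabs (D j c xi) <= K * (A c / sqrt c ^ n)).
  { assert (Hw : forall j c, (j <= n)%nat -> 0 < c <= c1 -> A c / sqrt c ^ j <= A c / sqrt c ^ n).
    { intros j c Hj Hc. apply Rmult_le_compat_l; [apply HA, Hc|]. rewrite <- !pow_inv.
      apply Rle_pow; [apply inv_sqrt_ge_1; lra | exact Hj]. }
    assert (Hp : forall c, 0 < c <= c1 -> 0 <= A c / sqrt c ^ n).
    { intros c Hc. apply Rdiv_le_0_compat; [apply HA, Hc | apply pow_lt, sqrt_lt_R0; lra]. }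
    induction m as [|m IH]; intros Hm.
    - destruct (D2 0%nat Hm) as [L [HL Hb]]. exists (L + 1). split; [lra|].
      intros j c xi Hj Hc Hxi. replace j with 0%nat by lia.
      apply Rle_trans with (1 := Hb c xi Hc Hxi).
      specialize (Hw 0%nat c Hm Hc). specialize (Hp c Hc).
      apply Rle_trans with (L * (A c / sqrt c ^ n)); [apply Rmult_le_compat_l; assumption | lra].
    - destruct (D2 (S m) Hm) as [L [HL Hb]]. destruct IH as [K [HK IH]]; [lia|].
      exists (K + L). split; [lra|]. intros j c xi Hj Hc Hxi.
      specialize (Hp c Hc). destruct (Nat.eq_dec j (S m)) as [->|Hne].
      + apply Rle_trans with (1 := Hb c xi Hc Hxi). specialize (Hw (S m) c Hm Hc).
        apply Rle_trans with (L * (A c / sqrt c ^ n)); [apply Rmult_le_compat_l; assumption | nra].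
      + apply Rle_trans with (K * (A c / sqrt c ^ n)); [apply IH; auto; lia | nra]. }
  destruct (HK n (le_n n)) as [K [HK0 HKb]]. exists K. split; [exact HK0|]. intros c Hc.
  apply Lub_Rbar_correct. intros r [j [x [Hj [Hx ->]]]].
  rewrite (Derive_n_on_eq 0 rad (g c) (fun j => D j c) n Hrad) by
    (auto; intros; rewrite D0; auto).
  apply HKb; assumption.
Qed.

(** The extra order [S n] makes the [n]-th derivative differentiable, hence continuous. *)
Lemma scaled_Cn_is_Ck (rad c1 : R) (n : nat) (A : R -> R) (F g : R -> R -> R) (c : R) :
  0 < rad -> scaled_Cn rad c1 (S n) A F ->
  (forall c xi, 0 < c <= c1 -> 0 <= xi <= rad -> g c xi = F c xi) ->
  0 < c <= c1 -> is_Ck n 0 rad (g c).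
Proof.
  intros Hrad H Hg Hc. destruct (scaled_Cn_derivatives _ _ _ _ _ H) as [D [D0 [D1 _]]].
  apply (is_Ck_of_derivatives 0 rad (g c) (fun j => D j c)); auto.
  intros y Hy. rewrite D0. auto.
Qed.

(** * The image terms other than the central one *)

Lemma scaled_Cn_id (rad c1 : R) (n : nat) :
  0 < rad -> c1 <= 1 -> scaled_Cn rad c1 n (fun _ => 1) (fun _ xi => xi).
Proof.
  intros Hr Hc1.
  assert (Hb : exists K, 0 <= K /\
    forall c xi : R, 0 < c <= c1 -> 0 <= xi <= rad -> Rabs xi <= K * 1).
  { exists rad. split; [lra|]. intros c xi _ Hxi. apply Rabs_le. lra. }
  destruct n as [|n]; (split; [exact Hb|]); [exact I|].
  exists (fun _ _ => 1). split.
  - intros c xi _ _. apply (is_derive_id (K := R_AbsRing)).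
  - apply scaled_Cn_const; [exact Hc1|]. intros c Hc. unfold Rdiv. rewrite Rmult_1_l.
    apply inv_sqrt_ge_1. lra.
Qed.

Lemma scaled_Cn_gauss (rad c1 : R) (n : nat) :
  0 < rad -> c1 <= 1 -> scaled_Cn rad c1 n (fun _ => 1) (fun _ xi => exp (- (xi ^ 2 / 4))).
Proof.
  intros Hr Hc1.
  assert (Hb : exists K, 0 <= K /\
    forall c xi : R, 0 < c <= c1 -> 0 <= xi <= rad -> Rabs (exp (- (xi ^ 2 / 4))) <= K * 1).
  { exists 1. split; [lra|]. intros c xi _ Hxi. rewrite Rabs_pos_eq by (left; apply exp_pos).
    rewrite Rmult_1_l, <- exp_0. apply exp_nondecreasing. nra. }
  induction n as [|n IH]; (split; [exact Hb|]); [exact I|].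
  exists (fun _ xi => (- / 2) * (xi * exp (- (xi ^ 2 / 4)))). split.
  - intros c xi _ _. auto_derive; [exact I|].
    change (xi * (xi * 1) * / 4) with (xi ^ 2 / 4). field.
  - apply scaled_Cn_scal; [exact Hc1|].
    apply scaled_Cn_weight with (fun c => 1 * 1).
    { intros c Hc. unfold Rdiv. rewrite !Rmult_1_l. apply inv_sqrt_ge_1. lra. }
    apply (scaled_Cn_mult rad c1 n (fun _ => 1) (fun _ => 1) (fun _ xi => xi)); [|exact IH].
    apply scaled_Cn_id; assumption.
Qed.

(** With [sigma] = 1 or -1 and [m = n + 1], the image centred at [2 * sigma * m], divided by the
    central Gaussian. The quotient is exponential in [xi], so its [j]-th derivative only brings the
    factor [(sigma * m / sqrt c) ^ j]. *)
Definition tail_term (sigma : R) (j : nat) (c : R) (n : nat) (xi : R) : R :=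
  (sigma * INR (S n) / sqrt c) ^ j
  * exp (- (INR (S n) ^ 2 / c) + sigma * INR (S n) * xi / sqrt c).

Definition tail_sum (sigma : R) (j : nat) (c xi : R) : R :=
  Series (fun n => tail_term sigma j c n xi).

Lemma tail_term_abs (sigma : R) (j : nat) (c : R) (n : nat) (xi r : R) :
  Rabs sigma = 1 -> 0 < c -> Rabs xi <= r ->
  Rabs (tail_term sigma j c n xi)
    <= / sqrt c ^ j * (INR (S n) ^ j * exp (- (/ c * INR (S n) ^ 2) + r / sqrt c * INR (S n))).
Proof.
  intros Hs Hc Hxi. unfold tail_term. set (m := INR (S n)).
  assert (Hm : 0 <= m) by apply pos_INR. pose proof (sqrt_lt_R0 c Hc) as Hq.
  assert (Hi : 0 < / sqrt c) by (apply Rinv_0_lt_compat, Hq).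
  rewrite Rabs_mult, (Rabs_pos_eq (exp _)) by (left; apply exp_pos).
  rewrite <- RPow_abs. unfold Rdiv. rewrite !Rabs_mult, Hs, Rmult_1_l, (Rabs_pos_eq m) by exact Hm.
  rewrite (Rabs_pos_eq (/ sqrt c)) by lra.
  rewrite Rpow_mult_distr, pow_inv, (Rmult_comm (m ^ j)), Rmult_assoc.
  apply Rmult_le_compat_l; [left; apply Rinv_0_lt_compat, pow_lt, Hq|].
  apply Rmult_le_compat_l; [apply pow_le, Hm|].
  apply exp_nondecreasing.
  assert (sigma * xi <= r).
  { apply Rle_trans with (Rabs (sigma * xi)); [apply Rle_abs|]. rewrite Rabs_mult, Hs. lra. }
  assert (m * / sqrt c * (sigma * xi) <= m * / sqrt c * r).
  { apply Rmult_le_compat_l; [apply Rmult_le_pos; lra | assumption]. }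
  replace (sigma * m * xi * / sqrt c) with (m * / sqrt c * (sigma * xi)) by ring.
  replace (r * / sqrt c * m) with (m * / sqrt c * r) by ring. lra.
Qed.

Lemma tail_term_dominated (sigma : R) (j : nat) (c : R) :
  Rabs sigma = 1 -> 0 < c -> locally_dominated (tail_term sigma j c).
Proof.
  intros Hs Hc r. eexists. split; [|intros n y Hy; apply tail_term_abs; eassumption].
  apply (ex_series_scal (V := R_NormedModule) (/ sqrt c ^ j)).
  apply ex_series_gaussian. apply Rinv_0_lt_compat, Hc.
Qed.

Lemma is_derive_tail_term (sigma : R) (j : nat) (c : R) (n : nat) (xi : R) :
  0 < c -> is_derive (tail_term sigma j c n) xi (tail_term sigma (S j) c n xi).
Proof.
  intros Hc. pose proof (sqrt_lt_R0 c Hc) as Hq. unfold tail_term.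
  generalize (INR (S n)). intros m. rewrite <- (tech_pow_Rmult (sigma * m / sqrt c)).
  generalize ((sigma * m / sqrt c) ^ j). intros p.
  auto_derive; [exact I|]. change (m * (m * 1)) with (m ^ 2). unfold Rdiv. ring.
Qed.

Lemma is_derive_tail_sum (sigma : R) (j : nat) (c xi : R) :
  Rabs sigma = 1 -> 0 < c -> is_derive (tail_sum sigma j c) xi (tail_sum sigma (S j) c xi).
Proof.
  intros Hs Hc. unfold tail_sum. apply is_derive_Series.
  - intros n y. apply is_derive_tail_term, Hc.
  - intros n y. eapply is_derive_continuous, is_derive_tail_term, Hc.
  - apply tail_term_dominated; assumption.
  - intros y. apply locally_dominated_ex_series, tail_term_dominated; assumption.
Qed.

(** The tail term with [m = 1], [sigma = 1], [j = 0] at the far end [xi = rad]. *)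
Definition error_scale (rad c : R) : R := exp (- (1 / c) + rad / sqrt c).

Lemma radius_over_sqrt_le (rad c : R) : 0 < c -> rad * sqrt c <= 1 -> rad / sqrt c <= / c.
Proof.
  intros Hc Hr. pose proof (sqrt_lt_R0 c Hc) as Hq.
  replace (rad / sqrt c) with (rad * sqrt c * / c).
  - rewrite <- (Rmult_1_l (/ c)) at 2. apply Rmult_le_compat_r; [left; apply Rinv_0_lt_compat, Hc | exact Hr].
  - rewrite <- (sqrt_sqrt c) at 2 by lra. field. lra.
Qed.

Lemma tail_sum_bound (rad sigma : R) (j : nat) :
  Rabs sigma = 1 -> exists K, 0 <= K /\ forall c xi, 0 < c <= 1 -> rad * sqrt c <= 1 ->
    0 <= xi <= rad -> Rabs (tail_sum sigma j c xi) <= K * (error_scale rad c / sqrt c ^ j).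
Proof.
  (* Relative to [m = 1], the term of index [m] has exponent [- (m ^ 2 - 1) / c + (m - 1) * rad /
     sqrt c]. As [rad / sqrt c <= / c] and [1 <= / c], this is at most [- (m ^ 2 - m)], the exponent
     in [B]. *)
  intros Hs. set (B := fun n => INR (S n) ^ j * exp (- (1 * INR (S n) ^ 2) + 1 * INR (S n))).
  assert (HB : ex_series B) by (apply ex_series_gaussian; lra).
  assert (HB0 : forall n, 0 <= B n).
  { intros n. apply Rmult_le_pos; [apply pow_le, pos_INR | left; apply exp_pos]. }
  exists (Series B). split.
  { apply Series_nonneg; assumption. }
  intros c xi Hc Hr Hxi. pose proof (sqrt_lt_R0 c (proj1 Hc)) as Hq.
  assert (Hp : 0 < / sqrt c ^ j) by (apply Rinv_0_lt_compat, pow_lt, Hq).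
  assert (Ht : forall n, Rabs (tail_term sigma j c n xi) <= (error_scale rad c / sqrt c ^ j) * B n).
  { intros n. eapply Rle_trans.
    - apply (tail_term_abs sigma j c n xi rad Hs (proj1 Hc)). apply Rabs_le; lra.
    - unfold error_scale, Rdiv. rewrite (Rmult_comm (exp _) (/ _)), (Rmult_assoc (/ sqrt c ^ j)).
      apply Rmult_le_compat_l; [lra|]. unfold B.
      rewrite <- Rmult_assoc, (Rmult_comm (exp (- (1 * / c) + _))), (Rmult_assoc (INR (S n) ^ j)).
      apply Rmult_le_compat_l; [apply pow_le, pos_INR|]. rewrite <- exp_plus. apply exp_nondecreasing. rewrite S_INR.
      pose proof (pos_INR n) as Hn. set (x := INR n) in *.
      pose proof (radius_over_sqrt_le rad c (proj1 Hc) Hr) as HR. unfold Rdiv in HR.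
      assert (Hi : 1 <= / c) by (rewrite <- Rinv_1; apply Rinv_le_contravar; lra).
      set (i := / c) in *. set (q := rad * / sqrt c) in *.
      assert (x * q <= x * i) by (apply Rmult_le_compat_l; assumption).
      assert ((x * x + x) * 1 <= (x * x + x) * i) by (apply Rmult_le_compat_l; nra).
      nra. }
  unfold tail_sum. eapply Rle_trans.
  - apply Series_Rabs. apply (ex_series_le (K := R_AbsRing) (V := R_CompleteNormedModule) _
      (fun n => (error_scale rad c / sqrt c ^ j) * B n)).
    + intros n. change norm with Rabs. rewrite Rabs_Rabsolu. apply Ht.
    + apply (ex_series_scal (V := R_NormedModule)), HB.
  - rewrite (Rmult_comm (Series B)), <- Series_scal_l. apply Series_le.
    + intros n; split; [apply Rabs_pos | apply Ht].
    + apply (ex_series_scal (V := R_NormedModule)), HB.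
Qed.

Lemma scaled_Cn_tail_sum (rad c1 sigma : R) (n j : nat) :
  Rabs sigma = 1 -> c1 <= 1 -> (forall c, 0 < c <= c1 -> rad * sqrt c <= 1) ->
  scaled_Cn rad c1 n (fun c => error_scale rad c / sqrt c ^ j) (tail_sum sigma j).
Proof.
  intros Hs Hc1 Hr. revert j.
  assert (Hb : forall j, exists K, 0 <= K /\ forall c xi, 0 < c <= c1 -> 0 <= xi <= rad ->
    Rabs (tail_sum sigma j c xi) <= K * (error_scale rad c / sqrt c ^ j)).
  { intros j. destruct (tail_sum_bound rad sigma j Hs) as [K [HK Hb]]. exists K.
    split; [exact HK|]. intros c xi Hc Hxi. apply Hb; auto; lra. }
  induction n as [|n IH]; intros j; (split; [apply Hb|]); [exact I|].
  exists (tail_sum sigma (S j)). split.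
  - intros c xi Hc _. apply is_derive_tail_sum; [exact Hs | lra].
  - apply scaled_Cn_weight with (2 := IH (S j)). intros c Hc. right.
    pose proof (sqrt_lt_R0 c (proj1 Hc)). simpl. field. split; [apply pow_nonzero|]; lra.
Qed.

Definition slope_error (c xi : R) : R :=
  / sqrt PI * (exp (- (xi ^ 2 / 4)) * (tail_sum 1 0 c xi + tail_sum (-1) 0 c xi)).

Lemma Rabs_neg1 : Rabs (-1) = 1.
Proof. rewrite Rabs_left by lra. ring. Qed.

Lemma gauss_image_exponent (q m xi s : R) :
  0 < q -> s * s = 1 ->
  - (/ (4 * (q * q)) * (xi * q - s * (2 * m)) ^ 2)
    = - (xi ^ 2 / 4) + (- (m ^ 2 / (q * q)) + s * m * xi / q).
Proof.
  intros Hq Hs.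
  replace ((xi * q - s * (2 * m)) ^ 2)
    with (xi ^ 2 * (q * q) - 4 * s * m * xi * q + 4 * (s * s) * m ^ 2) by ring.
  rewrite Hs. field. lra.
Qed.

Lemma theta_slope (c xi : R) :
  0 < c -> 0 <= xi * sqrt c <= 1 -> sqrt c * theta c (xi * sqrt c) = b_gauss xi + slope_error c xi.
Proof.
  intros Hc Hxi. rewrite theta_images by assumption. unfold b_gauss, slope_error, image_sum, tail_sum.
  pose proof (sqrt_lt_R0 c Hc) as Hq. pose proof (sqrt_sqrt c (Rlt_le _ _ Hc)) as Hqq.
  rewrite <- Rmult_plus_distr_l. f_equal. f_equal.
  - f_equal. f_equal. rewrite Rpow_mult_distr, pow2_sqrt by lra. field. lra.
  - rewrite <- Series_plus by (apply locally_dominated_ex_series, tail_term_dominated;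
      [first [exact Rabs_neg1 | apply Rabs_R1] | exact Hc]).
    rewrite <- Series_scal_l. apply Series_ext. intros n.
    unfold image_term, tail_term. rewrite !pow_O, !Rmult_1_l, Rmult_plus_distr_l, <- !exp_plus.
    generalize (INR (S n)). intros m. set (q := sqrt c) in *. clearbody q.
    rewrite <- Hqq. f_equal; f_equal.
    + rewrite <- (Rmult_1_l m) at 3. rewrite <- (gauss_image_exponent q m xi 1) by lra.
      f_equal. f_equal. ring.
    + rewrite <- (gauss_image_exponent q m xi (-1)) by lra.
      f_equal. f_equal. ring.
Qed.

(** * The difference of the profiles *)

Lemma derive_nonneg_le (f df : R -> R) (a b : R) :
  a <= b -> (forall x, a <= x <= b -> is_derive f x (df x)) ->
  (forall x, a <= x <= b -> 0 <= df x) -> f a <= f b.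
Proof.
  intros Hab Hd Hp. destruct (MVT_gen f a b df) as [x [Hx E]].
  - intros x Hx. rewrite Rmin_left, Rmax_right in Hx by exact Hab. apply Hd. lra.
  - intros x Hx. rewrite Rmin_left, Rmax_right in Hx by exact Hab.
    apply continuity_pt_filterlim. eapply is_derive_continuous, Hd, Hx.
  - rewrite Rmin_left, Rmax_right in Hx by exact Hab.
    assert (0 <= df x * (b - a)) by (apply Rmult_le_pos; [apply Hp, Hx | lra]). lra.
Qed.

(** * Positivity and the bounds on the denominators *)

Lemma phi_at_0 (c : R) : phi 0 c = 0.
Proof.
  unfold phi. rewrite (Series_single _ 0).
  - unfold phi_term. rewrite Rmult_0_r, sin_0. unfold Rdiv. ring.
  - intros k _. unfold phi_term. rewrite Rmult_0_r, sin_0. unfold Rdiv. ring.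
Qed.

Lemma phi_at_1 (c : R) : phi 1 c = 1.
Proof.
  assert (H : forall k, phi_term 1 c (S k) = 0).
  { intros k. unfold phi_term. rewrite Rmult_1_r, sin_eq_0_1.
    - unfold Rdiv. ring.
    - exists (Z.of_nat (S k)). rewrite <- INR_IZR_INZ. reflexivity. }
  unfold phi. rewrite (Series_single _ 0), H; [ring | intros; apply H].
Qed.

(** Invisible in the cosine series, evident for the images. *)
Lemma theta_nonneg (c y : R) : 0 < c -> 0 <= y <= 1 -> 0 <= theta c y.
Proof.
  intros Hc Hy. pose proof (sqrt_lt_R0 c Hc) as Hq.
  apply Rmult_le_reg_l with (sqrt c); [exact Hq|].
  rewrite Rmult_0_r, theta_images by assumption.
  apply Rmult_le_pos; [left; apply Rinv_0_lt_compat, sqrt_lt_R0, PI_RGT_0|].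
  apply Rplus_le_le_0_compat; [left; apply exp_pos|]. apply Series_nonneg.
  - apply (locally_dominated_ex_series (image_term (/ (4 * c)))), image_term_dominated.
    apply Rinv_0_lt_compat. lra.
  - intros n. apply Rplus_le_le_0_compat; left; apply exp_pos.
Qed.

Lemma phi_le_1 (c y : R) : 0 < c -> 0 <= y <= 1 -> phi y c <= 1.
Proof.
  intros Hc Hy. rewrite <- (phi_at_1 c).
  apply (derive_nonneg_le (fun z => phi z c) (theta c)); [lra | |].
  - intros x _. apply is_derive_phi, Hc.
  - intros x Hx. apply theta_nonneg; [exact Hc | lra].
Qed.

Lemma b_gauss_continuous (xi : R) : continuous b_gauss xi.
Proof. apply (ex_derive_continuous (V := R_NormedModule)). unfold b_gauss. auto_derive. exact I. Qed.

Lemma b_gauss_pos (xi : R) : 0 < b_gauss xi.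
Proof.
  apply Rmult_lt_0_compat; [apply Rinv_0_lt_compat, sqrt_lt_R0, PI_RGT_0 | apply exp_pos].
Qed.

Lemma is_derive_RInt_b_gauss (xi : R) : is_derive (fun x => RInt b_gauss 0 x) xi (b_gauss xi).
Proof.
  apply (is_derive_RInt (V := R_NormedModule) b_gauss _ 0 xi); [|apply b_gauss_continuous].
  apply filter_forall. intros y.
  apply (RInt_correct (V := R_CompleteNormedModule)), ex_RInt_continuous_global, b_gauss_continuous.
Qed.

Definition phi_scaled (c xi : R) : R := phi (xi * sqrt c) c.

Definition integral_error (c xi : R) : R := phi_scaled c xi - RInt b_gauss 0 xi.

Lemma is_derive_phi_scaled (c xi : R) :
  0 < c -> 0 <= xi * sqrt c <= 1 ->
  is_derive (phi_scaled c) xi (b_gauss xi + slope_error c xi).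
Proof.
  intros Hc Hxi. rewrite <- theta_slope by assumption.
  apply (is_derive_comp (fun z => phi z c) (fun x => x * sqrt c)).
  - apply is_derive_phi, Hc.
  - auto_derive; [exact I | ring].
Qed.

Lemma is_derive_integral_error (c xi : R) :
  0 < c -> 0 <= xi * sqrt c <= 1 -> is_derive (integral_error c) xi (slope_error c xi).
Proof.
  intros Hc Hxi.
  replace (slope_error c xi) with (minus (b_gauss xi + slope_error c xi) (b_gauss xi)).
  - apply (is_derive_minus (V := R_NormedModule)).
    + apply is_derive_phi_scaled; assumption.
    + apply is_derive_RInt_b_gauss.
  - change (b_gauss xi + slope_error c xi - b_gauss xi = slope_error c xi). ring.
Qed.

Lemma integral_error_at_0 (c : R) : integral_error c 0 = 0.
Proof.
  unfold integral_error, phi_scaled. rewrite Rmult_0_l, phi_at_0, RInt_point.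
  change (0 - 0 = 0). ring.
Qed.

Lemma tail_sum_0_nonneg (sigma c xi : R) : Rabs sigma = 1 -> 0 < c -> 0 <= tail_sum sigma 0 c xi.
Proof.
  intros Hs Hc. apply Series_nonneg.
  - apply locally_dominated_ex_series, tail_term_dominated; assumption.
  - intros n. unfold tail_term. rewrite pow_O, Rmult_1_l. left; apply exp_pos.
Qed.

Lemma slope_error_nonneg (c xi : R) : 0 < c -> 0 <= slope_error c xi.
Proof.
  intros Hc. apply Rmult_le_pos; [left; apply Rinv_0_lt_compat, sqrt_lt_R0, PI_RGT_0|].
  apply Rmult_le_pos; [left; apply exp_pos|].
  apply Rplus_le_le_0_compat; apply tail_sum_0_nonneg; auto using Rabs_R1, Rabs_neg1.
Qed.

Lemma interval_scaled (rad c xi : R) :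
  0 < c -> rad * sqrt c <= 1 -> 0 <= xi <= rad -> 0 <= xi * sqrt c <= 1.
Proof.
  intros Hc Hr Hxi. pose proof (sqrt_lt_R0 c Hc) as Hq. split.
  - apply Rmult_le_pos; lra.
  - apply Rle_trans with (rad * sqrt c); [apply Rmult_le_compat_r; lra | exact Hr].
Qed.

(** The error of the slope is a sum of positive images, so [integral_error] increases from 0; the
    upper bound is [phi_le_1]. Both integrals thus lie in [0, 1], without evaluating a Gaussian
    integral. *)
Lemma integrals_order (rad c xi : R) :
  0 < c -> rad * sqrt c <= 1 -> 0 <= xi <= rad ->
  0 <= RInt b_gauss 0 xi /\ RInt b_gauss 0 xi <= phi_scaled c xi /\ phi_scaled c xi <= 1.
Proof.
  intros Hc Hr Hxi. split; [|split].
  - apply RInt_ge_0; [lra | apply ex_RInt_continuous_global, b_gauss_continuous|].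
    intros; left; apply b_gauss_pos.
  - assert (integral_error c 0 <= integral_error c xi).
    { apply (derive_nonneg_le _ (slope_error c)); [lra | |].
      - intros x Hx. apply is_derive_integral_error; [exact Hc|].
        apply (interval_scaled rad); auto; lra.
      - intros x _. apply slope_error_nonneg, Hc. }
    rewrite integral_error_at_0 in H. unfold integral_error in H. lra.
  - apply phi_le_1; [exact Hc|]. apply (interval_scaled rad); auto.
Qed.

(** The right side is the convex combination [(1 - N) * 1 + N * exp M]. *)
Lemma one_plus_lower_bound (M N : R) :
  0 <= N <= 1 -> Rmin 1 (exp M) <= 1 + (exp M - 1) * N.
Proof.
  intros HN. unfold Rmin. destruct (Rle_dec 1 (exp M)) as [H|H]; [|apply Rnot_le_lt in H].
  - assert (0 <= (exp M - 1) * N) by (apply Rmult_le_pos; lra). lra.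
  - assert (0 <= (1 - exp M) * (1 - N)) by (apply Rmult_le_pos; lra). lra.
Qed.

Lemma Rmin_1_exp_pos (M : R) : 0 < Rmin 1 (exp M).
Proof. apply Rmin_pos; [lra | apply exp_pos]. Qed.

Lemma error_scale_pos (rad c : R) : 0 < error_scale rad c.
Proof. apply exp_pos. Qed.

Lemma error_scale_le_1 (rad c : R) : 0 < c -> rad * sqrt c <= 1 -> error_scale rad c <= 1.
Proof.
  intros Hc Hr. pose proof (radius_over_sqrt_le rad c Hc Hr).
  apply Rle_trans with (exp 0); [|rewrite exp_0; apply Rle_refl].
  apply exp_nondecreasing. replace (1 / c) with (/ c) by (field; lra). lra.
Qed.

(** * Scaled estimates for the ingredients and for the difference of the profiles *)

Lemma scaled_Cn_b_gauss (rad c1 : R) (n : nat) :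
  0 < rad -> c1 <= 1 -> scaled_Cn rad c1 n (fun _ => 1) (fun _ => b_gauss).
Proof. intros Hr Hc1. apply scaled_Cn_scal; [exact Hc1 | apply scaled_Cn_gauss; assumption]. Qed.

Lemma scaled_Cn_slope_error (rad c1 : R) (n : nat) :
  0 < rad -> c1 <= 1 -> (forall c, 0 < c <= c1 -> rad * sqrt c <= 1) ->
  scaled_Cn rad c1 n (error_scale rad) slope_error.
Proof.
  intros Hr Hc1 Hrc. apply scaled_Cn_scal; [exact Hc1|].
  apply scaled_Cn_weight with (fun c => 1 * (error_scale rad c / sqrt c ^ 0)).
  { intros c _. right. simpl. field. }
  apply (scaled_Cn_mult rad c1 n (fun _ => 1)); [apply scaled_Cn_gauss; assumption|].
  apply scaled_Cn_plus; apply scaled_Cn_tail_sum; auto using Rabs_R1, Rabs_neg1.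
Qed.

Lemma weight_le_div_sqrt (A c : R) : 0 <= A -> 0 < c <= 1 -> A <= A / sqrt c.
Proof.
  intros HA Hc. rewrite <- (Rmult_1_r A) at 1. apply Rmult_le_compat_l; [exact HA | apply inv_sqrt_ge_1, Hc].
Qed.

(** At order 0, the mean value theorem from the zero at the origin, which costs a factor [rad]; all
    further orders are those of [slope_error]. *)
Lemma scaled_Cn_integral_error (rad c1 : R) (n : nat) :
  0 < rad -> c1 <= 1 -> (forall c, 0 < c <= c1 -> rad * sqrt c <= 1) ->
  scaled_Cn rad c1 n (error_scale rad) integral_error.
Proof.
  intros Hr Hc1 Hrc.
  assert (HD : forall c x, 0 < c <= c1 -> 0 <= x <= rad ->
             is_derive (integral_error c) x (slope_error c x)).
  { intros c x Hc Hx. apply is_derive_integral_error; [lra|].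
    apply (interval_scaled rad); auto; lra. }
  assert (Hb : exists K, 0 <= K /\ forall c xi, 0 < c <= c1 -> 0 <= xi <= rad ->
             Rabs (integral_error c xi) <= K * error_scale rad c).
  { destruct (scaled_Cn_bound _ _ _ _ _ (scaled_Cn_slope_error rad c1 0 Hr Hc1 Hrc)) as [K [HK Hb]].
    exists (K * rad). split; [apply Rmult_le_pos; lra|]. intros c xi Hc Hxi.
    destruct (MVT_gen (integral_error c) 0 xi (slope_error c)) as [x [Hx E]].
    - intros x Hx. rewrite Rmin_left, Rmax_right in Hx by lra. apply HD; lra.
    - intros x Hx. rewrite Rmin_left, Rmax_right in Hx by lra.
      apply continuity_pt_filterlim. eapply is_derive_continuous, HD; lra.
    - rewrite Rmin_left, Rmax_right in Hx by lra.
      rewrite integral_error_at_0, !Rminus_0_r in E. rewrite E, Rabs_mult, (Rabs_pos_eq xi) by lra.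
      replace (K * rad * error_scale rad c) with (K * error_scale rad c * rad) by ring.
      apply Rmult_le_compat; try apply Rabs_pos; try lra. apply Hb; lra. }
  destruct n as [|n]; (split; [exact Hb|]); [exact I|].
  exists slope_error. split; [exact HD|].
  apply scaled_Cn_weight with (error_scale rad); [|apply scaled_Cn_slope_error; assumption].
  intros c Hc. apply weight_le_div_sqrt; [left; apply error_scale_pos | lra].
Qed.

Lemma scaled_Cn_RInt_b_gauss (rad c1 : R) (n : nat) :
  0 < rad -> c1 <= 1 -> (forall c, 0 < c <= c1 -> rad * sqrt c <= 1) ->
  scaled_Cn rad c1 n (fun _ => 1) (fun _ xi => RInt b_gauss 0 xi).
Proof.
  intros Hr Hc1 Hrc.
  assert (Hb : exists K, 0 <= K /\ forall c xi : R, 0 < c <= c1 -> 0 <= xi <= rad ->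
             Rabs (RInt b_gauss 0 xi) <= K * 1).
  { exists 1. split; [lra|]. intros c xi Hc Hxi.
    destruct (integrals_order rad c xi) as [H0 [H1 H2]]; auto; [lra|].
    rewrite Rabs_pos_eq; lra. }
  destruct n as [|n]; (split; [exact Hb|]); [exact I|].
  exists (fun _ => b_gauss). split; [intros; apply is_derive_RInt_b_gauss|].
  apply scaled_Cn_weight with (fun _ => 1); [|apply scaled_Cn_b_gauss; assumption].
  intros c Hc. apply weight_le_div_sqrt; lra.
Qed.

(** [Phi_c - f_M] over a common denominator: the terms without an error factor cancel. *)
Definition profile_difference (M c xi : R) : R :=
  (exp M - 1) *
  ((slope_error c xi * (1 + (exp M - 1) * RInt b_gauss 0 xi)
    + - (exp M - 1) * (b_gauss xi * integral_error c xi))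
   * (/ (1 + (exp M - 1) * (RInt b_gauss 0 xi + integral_error c xi))
      * / (1 + (exp M - 1) * RInt b_gauss 0 xi))).

Lemma profile_difference_eq (M rad c xi : R) :
  0 < c -> rad * sqrt c <= 1 -> 0 <= xi <= rad ->
  Phi_c M c xi - f_M M xi = profile_difference M c xi.
Proof.
  intros Hc Hr Hxi. destruct (integrals_order rad c xi Hc Hr Hxi) as [H0 [H1 H2]].
  pose proof (Rmin_1_exp_pos M) as Hd.
  pose proof (one_plus_lower_bound M (RInt b_gauss 0 xi) ltac:(lra)) as V1.
  pose proof (one_plus_lower_bound M (phi_scaled c xi) ltac:(lra)) as V2.
  unfold Phi_c, f_M, profile_difference.
  replace (phi_y (xi * sqrt c) c) with (theta c (xi * sqrt c))
    by (symmetry; apply is_derive_unique, is_derive_phi, Hc).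
  change (phi (xi * sqrt c) c) with (phi_scaled c xi).
  replace (sqrt c * ((exp M - 1) * theta c (xi * sqrt c) / (1 + (exp M - 1) * phi_scaled c xi)))
    with ((exp M - 1) * (sqrt c * theta c (xi * sqrt c)) / (1 + (exp M - 1) * phi_scaled c xi))
    by (field; lra).
  rewrite theta_slope by (auto; apply (interval_scaled rad); auto).
  replace (phi_scaled c xi) with (RInt b_gauss 0 xi + integral_error c xi) in *
    by (unfold integral_error; ring).
  field. split; lra.
Qed.

Lemma scaled_Cn_profile_difference (M rad c1 : R) (n : nat) :
  0 < rad -> c1 <= 1 -> (forall c, 0 < c <= c1 -> rad * sqrt c <= 1) ->
  scaled_Cn rad c1 n (error_scale rad) (profile_difference M).
Proof.
  intros Hr Hc1 Hrc. set (E := exp M - 1).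
  pose proof (scaled_Cn_slope_error rad c1 n Hr Hc1 Hrc) as HS.
  pose proof (scaled_Cn_integral_error rad c1 n Hr Hc1 Hrc) as HI.
  pose proof (scaled_Cn_RInt_b_gauss rad c1 n Hr Hc1 Hrc) as HN.
  assert (H1 : scaled_Cn rad c1 n (fun _ => 1) (fun _ _ => 1))
    by (apply scaled_Cn_const; [exact Hc1 | intros; lra]).
  assert (HV1 : scaled_Cn rad c1 n (fun _ => 1) (fun _ xi => 1 + E * RInt b_gauss 0 xi))
    by (apply (scaled_Cn_plus rad c1 n (fun _ => 1) (fun _ _ => 1)); [exact H1 | apply scaled_Cn_scal; assumption]).
  assert (HV2 : scaled_Cn rad c1 n (fun _ => 1) (fun c xi => 1 + E * (RInt b_gauss 0 xi + integral_error c xi))).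
  { apply (scaled_Cn_plus rad c1 n (fun _ => 1) (fun _ _ => 1)); [exact H1|].
    apply scaled_Cn_scal; [exact Hc1|]. apply scaled_Cn_plus; [exact HN|].
    (* In a denominator the error only has to be bounded, so its small weight is relaxed to 1. *)
    apply scaled_Cn_weight with (2 := HI). intros c Hc. apply error_scale_le_1; [lra | auto]. }
  assert (HD : scaled_Cn rad c1 n (fun _ => 1)
     (fun c xi => / (1 + E * (RInt b_gauss 0 xi + integral_error c xi)) * / (1 + E * RInt b_gauss 0 xi))).
  { apply scaled_Cn_weight with (fun c => 1 * 1); [intros; lra|].
    apply (scaled_Cn_mult rad c1 n (fun _ => 1) (fun _ => 1));
      (apply scaled_Cn_inv with (Rmin 1 (exp M)); [exact Hc1 | apply Rmin_1_exp_pos | | assumption]);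
      intros c xi Hc Hxi; destruct (integrals_order rad c xi) as [I0 [I1 I2]]; auto; try lra;
      apply one_plus_lower_bound; unfold integral_error; lra. }
  apply scaled_Cn_scal; [exact Hc1|].
  apply scaled_Cn_weight with (fun c => error_scale rad c * 1); [intros; lra|].
  apply scaled_Cn_mult; [|exact HD]. apply scaled_Cn_plus.
  - apply scaled_Cn_weight with (fun c => error_scale rad c * 1); [intros; lra|].
    apply scaled_Cn_mult; [exact HS | exact HV1].
  - apply scaled_Cn_scal; [exact Hc1|].
    apply scaled_Cn_weight with (fun c => 1 * error_scale rad c); [intros; lra|].
    apply (scaled_Cn_mult rad c1 n (fun _ => 1) _ (fun _ => b_gauss)); [|exact HI].
    apply scaled_Cn_b_gauss; assumption.
Qed.

(** * Asymptotics at the origin *)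

Lemma sqrt_radius (rad c : R) : 0 < rad -> 0 < c -> c <= / rad ^ 2 -> rad * sqrt c <= 1.
Proof.
  intros Hr Hc H.
  apply Rle_trans with (rad * / rad); [|right; field; lra].
  apply Rmult_le_compat_l; [lra|].
  rewrite <- (sqrt_pow2 (/ rad)) by (left; apply Rinv_0_lt_compat, Hr).
  apply sqrt_le_1_alt. rewrite pow_inv. exact H.
Qed.

Lemma error_scale_Rpower (rad c : R) (k : nat) :
  0 < c ->
  error_scale rad c / sqrt c ^ k = Rpower c (- (INR k / 2)) * exp (- (1 / c) + rad / sqrt c).
Proof.
  intros Hc. replace (- (INR k / 2)) with (/ 2 * - INR k) by field.
  rewrite <- Rpower_mult, Rpower_sqrt, Rpower_Ropp, Rpower_pow by (try apply sqrt_lt_R0; exact Hc).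
  unfold error_scale, Rdiv. apply Rmult_comm.
Qed.

Lemma error_scale_eps (rad eps c : R) (k : nat) :
  0 < eps -> 0 < c ->
  error_scale rad c / sqrt c ^ k
    <= INR (Factorial.fact k) * exp ((rad + 1) ^ 2 / (4 * eps)) * exp (- ((1 - eps) / c)).
Proof.
  intros He Hc. pose proof (sqrt_lt_R0 c Hc) as Hq.
  set (x := / sqrt c). assert (Hx : 0 < x) by (apply Rinv_0_lt_compat, Hq).
  assert (Hxx : / c = x ^ 2) by (unfold x; rewrite pow_inv, pow2_sqrt; lra).
  unfold error_scale, Rdiv. rewrite <- pow_inv. fold x. rewrite Hxx, Rmult_comm.
  (* The power [c ^ (- k / 2)] is [x ^ k] with [x = 1 / sqrt c], at most [k! * exp x]. The remaining
     linear term [(rad + 1) * x] is absorbed by [eps * x ^ 2], completing the square. *)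
  apply Rle_trans with (INR (Factorial.fact k) * exp x * exp (- (1 * x ^ 2) + rad * x)).
  - apply Rmult_le_compat_r; [left; apply exp_pos | apply pow_le_fact_exp; lra].
  - rewrite !Rmult_assoc. apply Rmult_le_compat_l; [apply pos_INR|]. rewrite <- !exp_plus.
    apply exp_nondecreasing.
    assert (0 <= (2 * eps * x - (rad + 1)) ^ 2 * / (4 * eps)).
    { apply Rmult_le_pos; [apply pow2_ge_0 | left; apply Rinv_0_lt_compat; lra]. }
    replace ((2 * eps * x - (rad + 1)) ^ 2 * / (4 * eps))
      with (eps * x ^ 2 - (rad + 1) * x + (rad + 1) ^ 2 * / (4 * eps)) in H by (field; lra).
    lra.
Qed.

(** The image of index [m = n + 2] relative to that of index 1, at the origin; [m = 2] gives the
    relative error [exp (- 3 / c)]. *)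
Definition rho_terms (c : R) (n : nat) : R := exp (- ((INR (S (S n)) ^ 2 - 1) / c)).

Lemma INR_SS_sqr (n : nat) : 4 <= INR (S (S n)) ^ 2.
Proof. rewrite !S_INR. pose proof (pos_INR n). nra. Qed.

(** Write [m ^ 2 - 1] as [3 + (m ^ 2 - 4)]: the 3 keeps its factor [/ c], the nonnegative rest uses
    only [1 <= / c] and leaves a series free of [c]. *)
Lemma rho_terms_le (c : R) (n : nat) :
  0 < c <= 1 -> rho_terms c n <= exp (- (3 / c)) * (exp 3 * rho_terms 1 n).
Proof.
  intros Hc. unfold rho_terms. rewrite <- !exp_plus. apply exp_nondecreasing.
  pose proof (INR_SS_sqr n) as H4. set (s := INR (S (S n)) ^ 2) in *.
  assert (Hi : 1 <= / c) by (rewrite <- Rinv_1; apply Rinv_le_contravar; lra).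
  unfold Rdiv. rewrite Rinv_1.
  assert ((s - 4) * 1 <= (s - 4) * / c) by (apply Rmult_le_compat_l; lra). lra.
Qed.

Lemma ex_series_rho_1 : ex_series (rho_terms 1).
Proof.
  eapply (ex_series_le (K := R_AbsRing) (V := R_CompleteNormedModule));
    [|apply (ex_series_gaussian 0 1 0 Rlt_0_1)].
  intros n. change norm with Rabs. unfold rho_terms. rewrite Rabs_pos_eq by (left; apply exp_pos).
  rewrite pow_O, Rmult_1_l. apply exp_nondecreasing. rewrite (S_INR (S n)), S_INR.
  pose proof (pos_INR n). unfold Rdiv. rewrite Rinv_1. nra.
Qed.

Lemma ex_series_rho (c : R) : 0 < c <= 1 -> ex_series (rho_terms c).
Proof.
  intros Hc. apply (ex_series_le (K := R_AbsRing) (V := R_CompleteNormedModule) _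
    (fun n => scal (exp (- (3 / c))) (scal (exp 3) (rho_terms 1 n)))).
  - intros n. change norm with Rabs. rewrite Rabs_pos_eq by (left; apply exp_pos).
    apply rho_terms_le, Hc.
  - apply (ex_series_scal (V := R_NormedModule)), (ex_series_scal (V := R_NormedModule)), ex_series_rho_1.
Qed.

Lemma rho_bounds (c : R) :
  0 < c <= 1 ->
  0 <= Series (rho_terms c) <= exp 3 * Series (rho_terms 1) * exp (- (3 / c)).
Proof.
  intros Hc. split.
  - apply Series_nonneg; [apply ex_series_rho, Hc | intros; left; apply exp_pos].
  - rewrite Rmult_comm, <- !Series_scal_l. apply Series_le.
    + intros n. split; [left; apply exp_pos | apply rho_terms_le, Hc].
    + apply (ex_series_scal (V := R_NormedModule)), (ex_series_scal (V := R_NormedModule)), ex_series_rho_1.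
Qed.

Lemma tail_sum_at_0 (sigma c : R) :
  Rabs sigma = 1 -> 0 < c -> tail_sum sigma 0 c 0 = exp (- (1 / c)) * (1 + Series (rho_terms c)).
Proof.
  intros Hs Hc. pose proof (sqrt_lt_R0 c Hc). unfold tail_sum.
  rewrite Series_incr_1 by (apply locally_dominated_ex_series, tail_term_dominated; assumption).
  rewrite Rmult_plus_distr_l, Rmult_1_r, <- Series_scal_l. f_equal.
  - unfold tail_term. rewrite pow_O, Rmult_1_l. f_equal. simpl. field. split; lra.
  - apply Series_ext. intros n. unfold tail_term, rho_terms. rewrite pow_O, Rmult_1_l, <- exp_plus.
    f_equal. field. split; lra.
Qed.

Lemma profile_difference_at_0 (M c : R) :
  0 < c ->
  profile_difference M c 0
    = (exp M - 1) * (2 / sqrt PI * exp (- (1 / c)) * (1 + Series (rho_terms c))).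
Proof.
  intros Hc. pose proof (sqrt_lt_R0 PI PI_RGT_0). unfold profile_difference.
  rewrite integral_error_at_0, RInt_point. change (zero (G := R_CompleteNormedModule)) with 0.
  unfold slope_error. rewrite !tail_sum_at_0 by auto using Rabs_R1, Rabs_neg1.
  replace (- (0 ^ 2 / 4)) with 0 by field. rewrite exp_0. field. lra.
Qed.

Lemma Ck_norm_ge_value (k : nat) (lo hi : R) (g : R -> R) (x : R) :
  lo <= x <= hi -> Rbar_le (Rabs (g x)) (Ck_norm k lo hi g).
Proof.
  intros Hx. apply (proj1 (Lub_Rbar_correct _)). exists 0%nat, x.
  split; [apply Nat.le_0_l | split; [exact Hx | reflexivity]].
Qed.

Lemma at_right_0_intro (P : R -> Prop) (d : R) :
  0 < d -> (forall c, 0 < c < d -> P c) -> at_right 0 P.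
Proof.
  intros Hd H. exists (mkposreal d Hd). intros c Hc Hp.
  change (Rabs (c - 0) < d) in Hc. rewrite Rminus_0_r, Rabs_pos_eq in Hc by lra.
  apply H. lra.
Qed.

Lemma log_asymptotics (kappa K c1 : R) (u rho : R -> R) :
  0 < kappa -> 0 < c1 -> (forall c, 0 < c <= c1 -> 0 <= rho c <= K) ->
  (forall c, 0 < c <= c1 -> u c = kappa * exp (- (1 / c)) * (1 + rho c)) ->
  filterlim (fun c => - c * ln (u c)) (at_right 0) (locally 1).
Proof.
  (* The deviation from the limit is [c] times [ln kappa + ln (1 + rho c)] up to sign, which [L]
     bounds; the added 1 makes [L] positive for the division [eps / L]. *)
  intros Hk Hc1 Hrho Hu. set (L := Rabs (ln kappa) + ln (1 + K) + 1).
  assert (HK : 0 <= K) by (destruct (Hrho c1); lra).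
  assert (HlnK : 0 <= ln (1 + K)) by (rewrite <- ln_1; apply ln_le; lra).
  pose proof (Rabs_pos (ln kappa)).
  assert (HL : 0 < L) by (unfold L; lra).
  apply filterlim_locally. intros eps. pose proof (cond_pos eps).
  apply at_right_0_intro with (Rmin c1 (eps / L)).
  - apply Rmin_pos; [exact Hc1 | apply Rdiv_lt_0_compat; assumption].
  - intros c [Hc Hm]. change (Rabs (- c * ln (u c) - 1) < eps).
    assert (Hcc : c < c1) by (apply Rlt_le_trans with (1 := Hm), Rmin_l).
    assert (Hce : c < eps / L) by (apply Rlt_le_trans with (1 := Hm), Rmin_r).
    destruct (Hrho c) as [R0 R1]; [lra|].
    rewrite Hu by lra.
    rewrite ln_mult, ln_mult, ln_exp; try apply exp_pos; try lra.
    2:{ apply Rmult_lt_0_compat; [exact Hk | apply exp_pos]. }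
    replace (- c * (ln kappa + - (1 / c) + ln (1 + rho c)) - 1)
      with (- (c * (ln kappa + ln (1 + rho c)))) by (field; lra).
    rewrite Rabs_Ropp, Rabs_mult, (Rabs_pos_eq c) by lra.
    assert (0 <= ln (1 + rho c)) by (rewrite <- ln_1; apply ln_le; lra).
    assert (ln (1 + rho c) <= ln (1 + K)) by (apply ln_le; lra).
    assert (Rabs (ln kappa + ln (1 + rho c)) <= L).
    { eapply Rle_trans; [apply Rabs_triang|]. rewrite (Rabs_pos_eq (ln (1 + rho c))) by assumption.
      unfold L. lra. }
    apply Rle_lt_trans with (c * L); [apply Rmult_le_compat_l; lra|].
    apply Rlt_le_trans with (eps / L * L); [apply Rmult_lt_compat_r; lra | right; field; lra].
Qed.

(** Comparing the two bounds gives [kappa * exp ((gamma - 1) / c) <= C], which fails for small [c];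
    [1 + t <= exp t] is enough. *)
Lemma no_faster_decay (kappa gamma c1 C : R) (u : R -> R) :
  0 < kappa -> 0 < c1 -> 1 < gamma ->
  (forall c, 0 < c <= c1 -> kappa * exp (- (1 / c)) <= u c) ->
  ~ at_right 0 (fun c => u c <= C * exp (- (gamma / c))).
Proof.
  intros Hk Hc1 Hg Hu [d Hd]. pose proof (cond_pos d).
  set (D := Rabs C + 1). pose proof (Rabs_pos C). assert (HD : 0 < D) by (unfold D; lra).
  (* For [c <= s] the linear term [kappa * (gamma - 1) / c] is at least [D], which exceeds [C]. *)
  set (s := kappa * (gamma - 1) / D).
  assert (Hs : 0 < s).
  { unfold s. apply Rdiv_lt_0_compat; [apply Rmult_lt_0_compat; lra | exact HD]. }
  set (c := Rmin (d / 2) (Rmin c1 s)).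
  assert (Hc : 0 < c) by (repeat apply Rmin_pos; lra).
  assert (C1 : c <= d / 2) by apply Rmin_l.
  assert (C2 : c <= c1) by (eapply Rle_trans; [apply Rmin_r | apply Rmin_l]).
  assert (C3 : c <= s) by (eapply Rle_trans; [apply Rmin_r | apply Rmin_r]).
  clearbody c. specialize (Hu c (conj Hc C2)).
  assert (Hb : u c <= C * exp (- (gamma / c))).
  { apply Hd; [|exact Hc]. change (Rabs (c - 0) < d). rewrite Rminus_0_r, Rabs_pos_eq; lra. }
  set (t := (gamma - 1) / c).
  assert (Ht : 0 < t) by (apply Rdiv_lt_0_compat; lra).
  assert (E : kappa * exp t <= C).
  { apply Rmult_le_reg_r with (exp (- (gamma / c))); [apply exp_pos|].
    apply Rle_trans with (2 := Hb). apply Rle_trans with (2 := Hu).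
    rewrite Rmult_assoc, <- exp_plus. right. f_equal. f_equal. unfold t. field. lra. }
  assert (kappa * (1 + t) <= kappa * exp t).
  { apply Rmult_le_compat_l; [lra | left; apply exp_ineq1; lra]. }
  pose proof (Rle_abs C).
  assert (HkD : kappa * t >= D).
  { unfold t. apply Rle_ge.
    apply Rmult_le_reg_r with c; [exact Hc|].
    replace (kappa * ((gamma - 1) / c) * c) with (s * D) by (unfold s; field; split; lra).
    rewrite (Rmult_comm D). apply Rmult_le_compat_r; lra. }
  unfold D in HkD. lra.
Qed.

Theorem theorem3p8 (M rad : R) (hM : M <> 0) (hrad : 0 < rad) :
  (exists c1 kappa_minus : R,
    0 < c1 /\ 0 < kappa_minus /\
    (forall c : R, 0 < c <= c1 -> rad <= / sqrt c) /\
    (* (i) *)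
    (forall k : nat,
      (forall c : R, 0 < c <= c1 -> is_Ck k 0 rad (fun xi => Phi_c M c xi - f_M M xi)) /\
      (exists kappa_plus : R, 0 < kappa_plus /\
        forall c : R, 0 < c <= c1 ->
          Rbar_le (Ck_norm k 0 rad (fun xi => Phi_c M c xi - f_M M xi))
                  (Finite (kappa_plus * Rpower c (- (INR k / 2))
                           * exp (- (1 / c) + rad / sqrt c)))) /\
      (forall eps : R, 0 < eps ->
        exists C_k_eps : R, forall c : R, 0 < c <= c1 ->
          Rbar_le (Ck_norm k 0 rad (fun xi => Phi_c M c xi - f_M M xi))
                  (Finite (C_k_eps * exp (- ((1 - eps) / c)))))) /\
    (* (ii) *)
    (exists (rho : R -> R) (K : R),
      (forall c : R, 0 < c <= c1 ->
        Rabs (Phi_c M c 0 - f_M M 0)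
          = 2 * Rabs (exp M - 1) / sqrt PI * exp (- (1 / c)) * (1 + rho c)) /\
      at_right 0 (fun c => Rabs (rho c) <= K * exp (- (3 / c)))) /\
    (forall c : R, 0 < c <= c1 ->
      kappa_minus * exp (- (1 / c)) <= Rabs (Phi_c M c 0 - f_M M 0)) /\
    filterlim (fun c => - c * ln (Rabs (Phi_c M c 0 - f_M M 0)))
      (at_right 0) (locally 1)) /\
  (* optimality of the exponent 1 *)
  (forall (k : nat) (gamma : R), 1 < gamma ->
    ~ exists C : R,
        at_right 0 (fun c =>
          Rbar_le (Ck_norm k 0 rad (fun xi => Phi_c M c xi - f_M M xi))
                  (Finite (C * exp (- (gamma / c)))))).
Proof.
  set (E := exp M - 1).
  assert (HE : E <> 0).
  { unfold E. intros H. apply hM. apply exp_inv. rewrite exp_0. lra. }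
  pose proof (Rabs_pos_lt E HE) as HE'. pose proof (sqrt_lt_R0 PI PI_RGT_0) as Hpi.
  (* The bound [/ rad ^ 2] expresses [rad <= / sqrt c]; the bound 1 makes negative powers of
     [sqrt c] grow with the order. *)
  set (c1 := Rmin 1 (/ rad ^ 2)).
  assert (Hc1 : 0 < c1) by (apply Rmin_pos; [lra | apply Rinv_0_lt_compat, pow_lt, hrad]).
  assert (Hc11 : c1 <= 1) by apply Rmin_l.
  assert (Hrc : forall c, 0 < c <= c1 -> rad * sqrt c <= 1).
  { intros c Hc. apply sqrt_radius; [exact hrad | lra|].
    apply Rle_trans with c1; [lra | apply Rmin_r]. }
  (* The leading coefficient at the origin. It also serves as [kappa_minus], because [rho] is
     nonnegative. *)
  set (kappa := 2 * Rabs E / sqrt PI).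
  assert (Hkappa : 0 < kappa) by (apply Rdiv_lt_0_compat; lra).
  set (rho := fun c => Series (rho_terms c)).
  set (K := exp 3 * Series (rho_terms 1)).
  assert (Hrho : forall c, 0 < c <= c1 -> 0 <= rho c <= K * exp (- (3 / c))).
  { intros c Hc. apply rho_bounds. lra. }
  assert (Hdiff : forall c xi, 0 < c <= c1 -> 0 <= xi <= rad ->
            Phi_c M c xi - f_M M xi = profile_difference M c xi).
  { intros c xi Hc Hxi. apply (profile_difference_eq M rad); auto; lra. }
  assert (Hval : forall c, 0 < c <= c1 ->
            Rabs (Phi_c M c 0 - f_M M 0) = kappa * exp (- (1 / c)) * (1 + rho c)).
  { intros c Hc. rewrite Hdiff, profile_difference_at_0 by lra. fold E. fold (rho c).
    destruct (Hrho c Hc) as [R0 _]. pose proof (exp_pos (- (1 / c))).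
    rewrite Rabs_mult, (Rabs_pos_eq (2 / sqrt PI * exp (- (1 / c)) * (1 + rho c))).
    - unfold kappa. field. lra.
    - apply Rmult_le_pos; [apply Rmult_le_pos; [apply Rdiv_le_0_compat|]|]; lra. }
  assert (Hlow : forall c, 0 < c <= c1 ->
            kappa * exp (- (1 / c)) <= Rabs (Phi_c M c 0 - f_M M 0)).
  { intros c Hc. rewrite Hval by exact Hc. destruct (Hrho c Hc) as [R0 _].
    rewrite <- (Rmult_1_r (kappa * exp (- (1 / c)))) at 1.
    apply Rmult_le_compat_l; [|lra].
    apply Rmult_le_pos; [lra | left; apply exp_pos]. }
  assert (HCk : forall k, exists B, 0 < B /\ forall c, 0 < c <= c1 ->
            Rbar_le (Ck_norm k 0 rad (fun xi => Phi_c M c xi - f_M M xi))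
                    (B * (error_scale rad c / sqrt c ^ k))).
  { intros k. apply (scaled_Cn_Ck_norm rad c1 k (error_scale rad) (profile_difference M)
      (fun c xi => Phi_c M c xi - f_M M xi)); auto.
    - intros c _. left. apply error_scale_pos.
    - apply scaled_Cn_profile_difference; assumption. }
  split.
  - exists c1, kappa. split; [exact Hc1|]. split; [exact Hkappa|]. split; [|split; [|split; [|split]]].
    + intros c Hc. pose proof (sqrt_lt_R0 c (proj1 Hc)).
      apply Rmult_le_reg_r with (sqrt c); [assumption|]. rewrite Rinv_l by lra. auto.
    + intros k. destruct (HCk k) as [B [HB Hk]]. split; [|split].
      * intros c Hc. apply (scaled_Cn_is_Ck rad c1 k (error_scale rad) (profile_difference M)
          (fun c xi => Phi_c M c xi - f_M M xi)); auto.
        apply scaled_Cn_profile_difference; assumption.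
      * exists B. split; [exact HB|]. intros c Hc.
        rewrite Rmult_assoc, <- error_scale_Rpower by lra. apply Hk, Hc.
      * intros eps He.
        exists (B * (INR (Factorial.fact k) * exp ((rad + 1) ^ 2 / (4 * eps)))). intros c Hc.
        eapply Rbar_le_trans; [apply Hk, Hc|]. simpl. rewrite Rmult_assoc.
        apply Rmult_le_compat_l; [lra|]. apply error_scale_eps; lra.
    + exists rho, K. split; [exact Hval|].
      apply at_right_0_intro with c1; [exact Hc1|]. intros c Hc.
      destruct (Hrho c) as [R0 R1]; [lra|]. rewrite Rabs_pos_eq; assumption.
    + exact Hlow.
    + apply (log_asymptotics kappa K c1 _ rho); auto.
      intros c Hc. destruct (Hrho c Hc) as [R0 R1]. split; [exact R0|].
      apply Rle_trans with (1 := R1). rewrite <- (Rmult_1_r K) at 2.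
      apply Rmult_le_compat_l.
      * apply Rmult_le_pos; [left; apply exp_pos|].
        apply Series_nonneg; [apply ex_series_rho_1 | intros; left; apply exp_pos].
      * apply Rle_trans with (exp 0); [|rewrite exp_0; apply Rle_refl].
        apply exp_nondecreasing. assert (0 < 3 / c) by (apply Rdiv_lt_0_compat; lra). lra.
  - intros k gamma Hg [C HC].
    (* Every norm dominates the value at the origin, whose lower bound already excludes [gamma > 1]
       for all [k] at once. *)
    apply (no_faster_decay kappa gamma c1 C (fun c => Rabs (Phi_c M c 0 - f_M M 0))); auto.
    generalize HC. apply filter_imp. intros c H.
    exact (Rbar_le_trans _ _ _ (Ck_norm_ge_value k 0 rad _ 0 (conj (Rle_refl 0) (Rlt_le _ _ hrad))) H).
Qed.
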